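(* Let $3\le n<\omega$. Then the frame $\mathfrak{s}^{n-3,n}$ is not weakly successful.
   Context: Hart–Shelah class $\mathbf{K}^n$ ($n\ge2$): models $M$ with sorts $I(M)$ (index set), $K(M)=[I(M)]^n$ with membership, $H\cong\mathbb{Z}_2$, $G(M)=\bigoplus_{u\in K}\mathbb{Z}_2$ with evaluation and support functions, $G^*(M)$ with projection onto $K$ and a regular $G$-action on each stalk, $H^*(M)$ with projection onto $K$ and a regular $\mathbb{Z}_2$-action on each stalk, and $Q\subseteq(G^* )^n\times H^*$ symmetric in the first $n$ arguments, holding only on compatible stalk indices (all $n$-subsets of one $(n+1)$-subset of $I$), such that moving $x_\ell$ by $\gamma_\ell\in G$ and $y\in H^*_v$ by $m\in\mathbb{Z}_2$ preserves the truth value of $Q$ iff $\gamma_1(v)+\dots+\gamma_n(v)+m\equiv0\pmod2$. It is $\mathbb{L}_{\omega_1,\omega}$-axiomatizable and ordered by $\mathbb{L}_{\omega_1,\omega}$-elementary substructure; $\mathbf{K}^n_\lambda$ = models of cardinality $\lambda$. $\mathfrak{s}^{k,n}$ ($n\ge3$, $k\le n-3$): the good $\aleph_k$-frame on $\mathbf{K}^n_{\aleph_k}$ whose basic types over $M$ are $\mathrm{gtp}(a/M;N)$ with $a\in I(N)\setminus I(M)$, and where for $M_0\le M_1\le M_2$, $\mathrm{gtp}(a/M_1;M_2)$ does not fork over $M_0$ iff $a\in I(M_2)\setminus I(M_1)$. Uniqueness triple (for a good $\lambda$-frame): $(a,M,N)$ with $M\le N$ in $\mathbf{K}_\lambda$,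 $a\in N\setminus M$, $\mathrm{gtp}(a/M;N)$ basic, such that for every $M_1\ge M$ in $\mathbf{K}_\lambda$ there is, up to equivalence over $M$, a unique amalgam $(f_1,f_2,N_1)$ ($N_1\in\mathbf{K}_\lambda$, $f_1:N\to N_1$, $f_2:M_1\to N_1$ embeddings fixing $M$) with $\mathrm{gtp}(f_1(a)/f_2[M_1];N_1)$ not forking over $M$; amalgams $(f^x_1,f^x_2,N^x)$, $x=a,b$, are equivalent over $M$ if there are $N_*\in\mathbf{K}_\lambda$, $f^x:N^x\to N_*$ with $f^af^a_\ell=f^bf^b_\ell$. Weakly successful: every basic type is $\mathrm{gtp}(a/M;N)$ for some uniqueness triple $(a,M,N)$. *)

(* Defs.v *)
From Stdlib Require Import List.
From mathcomp Require Import all_boot.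
Set Implicit Arguments. Unset Strict Implicit. Unset Printing Implicit Defensive.

Definition card_le (A B : Type) : Prop := exists f : A -> B, injective f.
Definition card_eq (A B : Type) : Prop := exists f : A -> B, bijective f.

(* aleph_0 = |nat|; T has size aleph_(k+1) iff T has a subset of size
   aleph_k, T does not inject into it, and every subset of T has size
   <= aleph_k or equal to |T| (so |T| is the successor of aleph_k). *)
Fixpoint isAleph (k : nat) (T : Type) : Prop :=
  match k with
  | 0 => card_eq T nat
  | k'.+1 => exists A : T -> Prop,
      [/\ isAleph k' {x | A x}, ~ card_le T {x | A x} &
          forall B : T -> Prop, card_le {x | B x} {x | A x} \/ card_eq {x | B x} T]
  end.

Inductive sort := SI | SK | SH | SG | SGs | SHs.

Definition sort_eq_dec (s t : sort) : {s = t} + {s <> t}.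
Proof. decide equality. Defined.

Section HartShelah.
Variable n : nat.

Record struc := Struc {
  sI : Type; sK : Type; sH : Type; sG : Type; sGs : Type; sHs : Type;
  mem : sI -> sK -> Prop;
  hzero : sH; hadd : sH -> sH -> sH;      (* H = Z_2                   *)
  gzero : sG; gadd : sG -> sG -> sG;      (* G = (+)_{u in K} Z_2       *)
  ev : sG -> sK -> sH;
  supp : sG -> sK -> Prop;
  pG : sGs -> sK; actG : sG -> sGs -> sGs;
  pH : sHs -> sK; actH : sH -> sHs -> sHs;
  Q : ('I_n -> sGs) -> sHs -> Prop
}.

Definition car (M : struc) (s : sort) : Type :=
  match s with
  | SI => sI M | SK => sK M | SH => sH M | SG => sG M | SGs => sGs M | SHs => sHs M
  end.

Definition universe (M : struc) : Type := {s : sort & car M s}.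

Definition hsum (M : struc) (gam : 'I_n -> sG M) (v : sK M) (m : sH M) : sH M :=
  foldr (fun l acc => hadd (ev (gam l) v) acc) m (enum 'I_n).

(* stalk indices of x_1..x_n, y are pairwise distinct n-subsets of one
   (n+1)-subset w of I, i.e. they are all the n-subsets of w. *)
Definition compatible (M : struc) (x : 'I_n -> sGs M) (y : sHs M) : Prop :=
  exists w : 'I_n.+1 -> sI M,
    [/\ injective w,
        forall l z, mem z (pG (x l)) -> exists j, w j = z,
        forall z, mem z (pH y) -> exists j, w j = z,
        injective (fun l => pG (x l)) &
        forall l, pG (x l) <> pH y].

Record inKn (M : struc) : Prop := {
  (* K(M) = [I(M)]^n with membership *)
  kn_members : forall u : sK M, exists f : 'I_n -> sI M,
      injective f /\ forall z, mem z u <-> exists j, f j = z;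
  kn_ext : forall u v : sK M, (forall z, mem z u <-> mem z v) -> u = v;
  kn_full : forall f : 'I_n -> sI M, injective f ->
      exists u : sK M, forall z, mem z u <-> exists j, f j = z;
  kn_H : exists e : sH M, [/\ e <> hzero M, forall h, h = hzero M \/ h = e,
      hadd (hzero M) (hzero M) = hzero M, hadd (hzero M) e = e &
      hadd e (hzero M) = e /\ hadd e e = hzero M];
  (* G = direct sum of Z_2 over K, via evaluation *)
  kn_ev_add : forall (a b : sG M) (u : sK M), ev (gadd a b) u = hadd (ev a u) (ev b u);
  kn_ev_zero : forall u : sK M, ev (gzero M) u = hzero M;
  kn_ev_inj : forall a b : sG M, (forall u, ev a u = ev b u) -> a = b;
  kn_ev_fin : forall a : sG M, exists l : list (sK M),
      forall u, ev a u <> hzero M -> In u l;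
  kn_ev_surj : forall h : sK M -> sH M,
      (exists l : list (sK M), forall u, h u <> hzero M -> In u l) ->
      exists a : sG M, forall u, ev a u = h u;
  kn_supp : forall (a : sG M) (u : sK M), supp a u <-> ev a u <> hzero M;
  kn_pG_onto : forall u : sK M, exists x, pG x = u;
  kn_actG_stalk : forall (a : sG M) (x : sGs M), pG (actG a x) = pG x;
  kn_actG_zero : forall x : sGs M, actG (gzero M) x = x;
  kn_actG_add : forall (a b : sG M) (x : sGs M), actG (gadd a b) x = actG a (actG b x);
  kn_actG_trans : forall x y : sGs M, pG x = pG y -> exists a, actG a x = y;
  kn_actG_free : forall (a b : sG M) (x : sGs M), actG a x = actG b x -> a = b;
  kn_pH_onto : forall u : sK M, exists y, pH y = u;
  kn_actH_stalk : forall (m : sH M) (y : sHs M), pH (actH m y) = pH y;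
  kn_actH_zero : forall y : sHs M, actH (hzero M) y = y;
  kn_actH_add : forall (m m' : sH M) (y : sHs M), actH (hadd m m') y = actH m (actH m' y);
  kn_actH_trans : forall y y' : sHs M, pH y = pH y' -> exists m, actH m y = y';
  kn_actH_free : forall (m m' : sH M) (y : sHs M), actH m y = actH m' y -> m = m';
  kn_Q_sym : forall sigma : 'I_n -> 'I_n, injective sigma ->
      forall (x : 'I_n -> sGs M) (y : sHs M), Q (fun l => x (sigma l)) y <-> Q x y;
  kn_Q_compat : forall (x : 'I_n -> sGs M) (y : sHs M), Q x y -> compatible x y;
  kn_Q_act : forall (x : 'I_n -> sGs M) (y : sHs M), compatible x y ->
      forall (gam : 'I_n -> sG M) (m : sH M),
      ((Q (fun l => actG (gam l) (x l)) (actH m y) <-> Q x y)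
         <-> hsum gam (pH y) m = hzero M)
}.

Inductive term : sort -> Type :=
  | tvar (s : sort) (i : nat) : term s
  | tpG : term SGs -> term SK
  | tpH : term SHs -> term SK
  | th0 : term SH
  | thadd : term SH -> term SH -> term SH
  | tev : term SG -> term SK -> term SH
  | tg0 : term SG
  | tgadd : term SG -> term SG -> term SG
  | tactG : term SG -> term SGs -> term SGs
  | tactH : term SH -> term SHs -> term SHs.

Inductive formula : Type :=
  | fEq (s : sort) : term s -> term s -> formula
  | fMem : term SI -> term SK -> formula
  | fSupp : term SG -> term SK -> formula
  | fQ : ('I_n -> term SGs) -> term SHs -> formula
  | fNeg : formula -> formula
  | fConj : (nat -> formula) -> formula
  | fEx (s : sort) (i : nat) : formula -> formula.

Fixpoint tfree (s0 : sort) (t : term s0) (s : sort) (j : nat) : Prop :=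
  match t with
  | tvar s1 i => s1 = s /\ i = j
  | tpG t1 => tfree t1 s j
  | tpH t1 => tfree t1 s j
  | th0 => False
  | thadd t1 t2 => tfree t1 s j \/ tfree t2 s j
  | tev t1 t2 => tfree t1 s j \/ tfree t2 s j
  | tg0 => False
  | tgadd t1 t2 => tfree t1 s j \/ tfree t2 s j
  | tactG t1 t2 => tfree t1 s j \/ tfree t2 s j
  | tactH t1 t2 => tfree t1 s j \/ tfree t2 s j
  end.

Fixpoint free (phi : formula) (s : sort) (j : nat) : Prop :=
  match phi with
  | fEq _ t u => tfree t s j \/ tfree u s j
  | fMem t u => tfree t s j \/ tfree u s j
  | fSupp t u => tfree t s j \/ tfree u s j
  | fQ ts t => (exists l, tfree (ts l) s j) \/ tfree t s j
  | fNeg psi => free psi s j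
  | fConj f => exists k, free (f k) s j
  | fEx s1 i psi => free psi s j /\ ~ (s1 = s /\ i = j)
  end.

(* L_{omega_1,omega} formulas have finitely many free variables *)
Definition finfree (phi : formula) : Prop :=
  exists m, forall s j, free phi s j -> j < m.

Definition assignment (M : struc) := forall s : sort, nat -> car M s.

Definition upd (M : struc) (rho : assignment M) (s : sort) (i : nat) (a : car M s)
  : assignment M :=
  fun s' j =>
    match sort_eq_dec s s' with
    | left e => if j == i then eq_rect s (car M) a s' e else rho s' j
    | right _ => rho s' j
    end.

Fixpoint teval (M : struc) (rho : assignment M) (s0 : sort) (t : term s0) : car M s0 :=
  match t in term s1 return car M s1 with
  | tvar s1 i => rho s1 i
  | tpG t1 => @pG M (teval rho t1)
  | tpH t1 => @pH M (teval rho t1)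
  | th0 => hzero M
  | thadd t1 t2 => @hadd M (teval rho t1) (teval rho t2)
  | tev t1 t2 => @ev M (teval rho t1) (teval rho t2)
  | tg0 => gzero M
  | tgadd t1 t2 => @gadd M (teval rho t1) (teval rho t2)
  | tactG t1 t2 => @actG M (teval rho t1) (teval rho t2)
  | tactH t1 t2 => @actH M (teval rho t1) (teval rho t2)
  end.

Fixpoint sat (M : struc) (rho : assignment M) (phi : formula) : Prop :=
  match phi with
  | fEq _ t u => teval rho t = teval rho u
  | fMem t u => @mem M (teval rho t) (teval rho u)
  | fSupp t u => @supp M (teval rho t) (teval rho u)
  | fQ ts t => @Q M (fun l => teval rho (ts l)) (teval rho t)
  | fNeg psi => ~ sat rho psi
  | fConj f => forall k, sat rho (f k)
  | fEx s i psi => exists a : car M s, sat (upd rho i a) psi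
  end.

(* Maps between structures (sortwise) and L_{omega_1,omega}-elementary
   embeddings; M <= N means (up to the identification via such a map)
   that M is an L_{omega_1,omega}-elementary substructure of N. *)
Definition emb (M N : struc) := forall s : sort, car M s -> car N s.

Definition elem (M N : struc) (f : emb M N) : Prop :=
  forall (phi : formula) (rho : assignment M), finfree phi ->
    (sat rho phi <-> sat (fun s j => f s (rho s j)) phi).

Variable k : nat.

Definition inKl (M : struc) : Prop := inKn M /\ isAleph k (universe M).

Record ext (M : struc) := Ext { eN : struc; ei : emb M eN; ea : car eN SI }.
Arguments ei {M} e s _.
Arguments ea {M} e.
Arguments eN {M} e.

Definition valid_ext (M : struc) (e : ext M) : Prop := inKl (eN e) /\ elem (ei e).

Definition basic (M : struc) (e : ext M) : Prop :=
  ~ exists x : car M SI, ei e SI x = ea e.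

Definition gtp_step (M : struc) (e1 e2 : ext M) : Prop :=
  valid_ext e1 /\ valid_ext e2 /\
  exists (Ns : struc) (h1 : emb (eN e1) Ns) (h2 : emb (eN e2) Ns),
    [/\ inKl Ns, elem h1, elem h2,
        forall s x, h1 s (ei e1 s x) = h2 s (ei e2 s x) &
        h1 SI (ea e1) = h2 SI (ea e2)].

Inductive rtc (A : Type) (R : A -> A -> Prop) : A -> A -> Prop :=
  | rtc_refl x : rtc R x x
  | rtc_step x y z : R x y -> rtc R y z -> rtc R x z.

Definition gtp_eq (M : struc) (e1 e2 : ext M) : Prop := rtc (@gtp_step M) e1 e2.

(* amalgam (f1, f2, N1) of N and M1 over M with f1(a) not forking over M,
   i.e. f1(a) in I(N1) \ f2[I(M1)] *)
Definition nf_amalgam (M : struc) (e : ext M) (M1 : struc) (j : emb M M1)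
  (N1 : struc) (f1 : emb (eN e) N1) (f2 : emb M1 N1) : Prop :=
  [/\ inKl N1, elem f1, elem f2,
      forall s x, f1 s (ei e s x) = f2 s (j s x) &
      ~ exists y : car M1 SI, f2 SI y = f1 SI (ea e)].
Arguments nf_amalgam {M} e {M1} j {N1} f1 f2.

Definition uniqueness_triple (M : struc) (e : ext M) : Prop :=
  [/\ inKl M, valid_ext e, basic e &
   forall (M1 : struc) (j : emb M M1), inKl M1 -> elem j ->
     (exists (N1 : struc) (f1 : emb (eN e) N1) (f2 : emb M1 N1),
         nf_amalgam e j f1 f2) /\
     (forall (Na : struc) (fa1 : emb (eN e) Na) (fa2 : emb M1 Na)
             (Nb : struc) (fb1 : emb (eN e) Nb) (fb2 : emb M1 Nb),
        nf_amalgam e j fa1 fa2 -> nf_amalgam e j fb1 fb2 ->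
        exists (Ns : struc) (ga : emb Na Ns) (gb : emb Nb Ns),
          [/\ inKl Ns, elem ga, elem gb,
              forall s x, ga s (fa1 s x) = gb s (fb1 s x) &
              forall s x, ga s (fa2 s x) = gb s (fb2 s x)])].

Definition weakly_successful : Prop :=
  forall (M : struc) (e : ext M), inKl M -> valid_ext e -> basic e ->
    exists e' : ext M, uniqueness_triple e' /\ gtp_eq e e'.

End HartShelah.

(* Main.v *)
Require Import Defs.
From Stdlib Require Inverse_Image Eqdep_dec.
From mathcomp Require Import all_boot.
From mathcomp Require Import boolp wochoice finmap.
Set Implicit Arguments. Unset Strict Implicit. Unset Printing Implicit Defensive.

(** After choosing a base point in every stalk, a model is given by its index
set I and by the truth values of Q on base points, i.e. by a function eps of an
(n+1)-subset w of I and of v in [w]^n, which can be prescribed arbitrarily.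
Moving finitely many base points changes eps at will on the simplices through a
new point, so that a back-and-forth argument makes all embeddings of models with
infinite I elementary.

Let (a, M, N) be a triple with |I(M)| = aleph_(n-3), and let M1 be M with one new
point b.  Two amalgams with index set I(N) + b are obtained by prescribing Q on
the simplices through b in two ways, differing only when w contains a, b and c0
and v does not contain c0, with c0, c1 two points of I(M).  An equivalence of the
amalgams shifts the base point of u by some gamma_u in G, where gamma_u = 0 if u
is in I(N) or in I(M1).  Comparing the simplices v + c0 and v + c1 for
v = {a, b} + s, with s an (n-2)-subset of I(M), shows that v lies in the support
of gamma_u for some u = {a, b} + (s - z) + c_i.  Supports being finite, this gives
a map from the (n-3)-subsets r of I(M) to finite sets F(r) such that no
(n-2)-subset s satisfies z notin F(s - z) for all z in s, contradicting
Kuratowski's free set theorem for aleph_(n-3). *)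

(** * Cardinals *)

Lemma ex_choice X Y (P : X -> Y -> Prop) :
  (forall x, exists y, P x y) -> exists f, forall x, P x (f x).
Proof. by move=> /boolp.choice[f fP]; exists f. Qed.

Section Cardinals.
Implicit Types A B C T U : Type.

Lemma card_le_refl A : card_le A A.
Proof. by exists id. Qed.

Lemma card_le_trans A B C : card_le A B -> card_le B C -> card_le A C.
Proof. by move=> [f injf] [g injg]; exists (g \o f); apply: inj_comp. Qed.

Lemma card_eq_le A B : card_eq A B -> card_le A B.
Proof. by move=> [f /bij_inj injf]; exists f. Qed.

Lemma card_eq_sym A B : card_eq A B -> card_eq B A.
Proof. by move=> [f [g fK gK]]; exists g; exists f. Qed.

Lemma card_eq_trans A B C : card_eq A B -> card_eq B C -> card_eq A C.
Proof. by move=> [f bijf] [g bijg]; exists (g \o f); apply: bij_comp. Qed.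

Lemma inj_surj_bij A B (f : A -> B) :
  injective f -> (forall b, exists a, f a = b) -> bijective f.
Proof.
move=> injf /ex_choice[g gK].
by exists g => a //; apply: (injf _ _ _); rewrite gK.
Qed.

(** Schroeder-Bernstein: [C] collects the points reached by iterating [g \o f] from outside the
    range of [g]; the bijection is [f] on [C] and the inverse of [g] off [C]. *)
Lemma card_le_antisym A B : card_le A B -> card_le B A -> card_eq A B.
Proof.
move=> [f injf] [g injg].
pose C a := exists m a0, (forall b, g b <> a0) /\ a = iter m (g \o f) a0.
have nC a : ~ C a -> exists b, g b = a.
  move=> nCa; apply: contrapT => nb; apply: nCa; exists 0, a; split=> // b gb.
  by apply: nb; exists b.
have [h hP] : exists h : A -> B, forall a, (C a -> h a = f a) /\ (~ C a -> g (h a) = a).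
  apply: (@ex_choice _ _ (fun a b => (C a -> b = f a) /\ (~ C a -> g b = a))) => a.
  have [Ca|nCa] := pselect (C a).
    by exists (f a).
  by have [b gb] := nC a nCa; exists b.
have Cgf a : C (g (f a)) -> C a.
  move=> [[|m] [a0 [ga0 /= e]]]; first by case: (ga0 (f a)).
  by exists m, a0; split=> //; exact: injf (injg _ _ e).
have Cgf' a : C a -> C (g (f a)).
  by move=> [m [a0 [ga0 ->]]]; exists m.+1, a0.
exists h; apply: inj_surj_bij => [a a' e|b].
  have [[h1 h2] [h1' h2']] := (hP a, hP a').
  have [Ca|nCa] := pselect (C a); have [Ca'|nCa'] := pselect (C a').
  - by apply: injf; rewrite -h1 // -h1'.
  - by case: (nCa'); rewrite -(h2' nCa') -e h1 //; exact: Cgf'.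
  - by case: (nCa); rewrite -(h2 nCa) e h1' //; exact: Cgf'.
  - by rewrite -(h2 nCa) -(h2' nCa') e.
have [Cgb|nCgb] := pselect (C (g b)).
  have [[|m] [a0 [ga0 e]]] := Cgb; first by case: (ga0 b).
  exists (iter m (g \o f) a0); rewrite (hP _).1; last by exists m, a0.
  exact: injg.
by exists (g b); apply: injg; rewrite (hP _).2.
Qed.

Lemma card_le_surj A B (f : A -> B) : (forall b, exists a, f a = b) -> card_le B A.
Proof. by move=> /ex_choice[g gK]; exists g => b b' e; rewrite -(gK b) e gK. Qed.

Lemma card_le_sub T (P : T -> Prop) : card_le {x | P x} T.
Proof. by exists sval => -[x p] [y q] /= e; apply: eq_exist. Qed.

Lemma isAleph_eq k T U : isAleph k T -> card_eq T U -> isAleph k U.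
Proof.
elim: k T U => [|k IH] T U /=.
  by move=> TN TU; apply: card_eq_trans TN; exact: card_eq_sym.
move=> [A [Ak nTA TB]] [f [g fK gK]].
have tr (P : T -> Prop) : card_eq {x | P x} {y | P (g y)}.
  have p x : P x -> P (g (f x)) by rewrite fK.
  exists (fun x => exist (fun y => P (g y)) (f (sval x)) (p _ (svalP x))).
  exists (fun y => exist P (g (sval y)) (svalP y)).
    by move=> [x q]; apply: eq_exist; rewrite /= fK.
  by move=> [x q]; apply: eq_exist; rewrite /= gK.
have UT : card_eq U T by exists g; exists f.
exists (fun y => A (g y)); split.
- exact: IH Ak (tr A).
- move=> le; apply: nTA.
  apply: card_le_trans (card_eq_le (card_eq_sym UT)) _.
  exact: card_le_trans le (card_eq_le (card_eq_sym (tr A))).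
move=> B; pose B' x := B (f x).
have eB : card_eq {x | B' x} {y | B y}.
  have := tr B'; rewrite /B'.
  have -> // : (fun y => B (f (g y))) = B by apply: funext => y; rewrite gK.
case: (TB B') => le; [left|right].
  apply: card_le_trans (card_eq_le (card_eq_sym eB)) _.
  exact: card_le_trans le (card_eq_le (tr A)).
apply: card_eq_trans (card_eq_sym eB) _.
by apply: card_eq_trans le _; exact: card_eq_sym.
Qed.

Record wellorder W (lt : W -> W -> Prop) : Prop := Wellorder {
  wo_wf : well_founded lt;
  wo_total : forall x y, [\/ lt x y, x = y | lt y x] }.

Lemma wf_min W (lt : W -> W -> Prop) (P : W -> Prop) : well_founded lt ->
  (exists x, P x) -> exists x, P x /\ forall y, lt y x -> ~ P y.
Proof.
move=> wf [x]; elim/(well_founded_ind wf): x => x IH Px.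
have [[y [ltyx Py]]|none] := pselect (exists y, lt y x /\ P y); first exact: IH Py.
by exists x; split=> // y ltyx Py; apply: none; exists y.
Qed.

Lemma wellorder_exists T : exists lt : T -> T -> Prop, wellorder lt.
Proof.
have [R wR] := well_ordering_principle {classic T}.
pose lt (x y : T) := R (x : {classic T}) (y : {classic T}) /\ x <> y.
(* Least elements for [Prop]-valued predicates. On a pair of points they give totality, on the
   points that are not accessible well-foundedness. *)
have mn (P : T -> Prop) : (exists x, P x) ->
    exists2 x, P x & forall y, P y -> R (x : {classic T}) (y : {classic T}).
  move=> [x Px].
  have [|z [[Pz zmin] _]] := wR (fun y : {classic T} => `[<P y>]).
    by exists x; apply/asboolP.
  exists z; first exact/asboolP.
  by move=> y Py; apply: zmin; apply/asboolP.
have anti (x y : T) : R (x : {classic T}) (y : {classic T}) -> R (y : {classic T}) (x : {classic T}) -> x = y.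
  move=> xy yx.
  have [|z [[Pz zmin] zu]] := wR (fun t : {classic T} => `[<t = x \/ t = y>]).
    by exists x; apply/asboolP; left.
  have rfl (t : T) : R (t : {classic T}) (t : {classic T}).
    have [|t' -> h] := mn (fun t' => t' = t); first by exists t.
    exact: h.
  have m t : t = x \/ t = y -> z = t.
    move=> ht; apply: zu; split; first exact/asboolP.
    by move=> s /asboolP hs; case: ht hs => -> [] ->.
  by rewrite -(m x (or_introl erefl)) -(m y (or_intror erefl)).
exists lt; split.
  move=> x; apply: contrapT => nx.
  have [|z nz zmin] := mn (fun x => ~ Acc lt x); first by exists x.
  apply: nz; constructor=> y [Ryz nyz]; apply: contrapT => ny.
  by apply: nyz; apply: anti => //; exact: zmin.
move=> x y; have [[->]|nxy] := pselect (x = y); first by constructor 2.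
have [|z zP zmin] := mn (fun t => t = x \/ t = y); first by exists x; left.
have [zx zy] := (zmin x (or_introl erefl), zmin y (or_intror erefl)).
by case: zP zx zy => -> zx zy; [constructor 1|constructor 3]; split=> // e; apply: nxy.
Qed.

Definition segment W (lt : W -> W -> Prop) w := {x | lt x w}.

(* Map w to a fresh element of U, outside the images of its predecessors. *)
Lemma segments_card_le W (lt : W -> W -> Prop) U : wellorder lt ->
  (forall w, ~ card_le U (segment lt w)) -> card_le W U.
Proof.
move=> [wf tot] nU.
have fresh w (f : forall x, lt x w -> U) : exists u, forall x (xw : lt x w), f x xw <> u.
  apply: contrapT => nfresh; apply: (nU w).
  apply: (@card_le_surj _ _ (fun x : segment lt w => f (sval x) (proj2_sig x))) => u.
  apply: contrapT => nu; apply: nfresh; exists u => x xw e.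
  by apply: nu; exists (exist _ x xw).
pose step w f := sval (cid (fresh w f)).
pose F := Fix wf (fun _ => U) step.
have FE w : F w = step w (fun x _ => F x).
  apply: (Fix_eq wf (fun _ => U)) => x f g fg; congr (step x _).
  by apply: functional_extensionality_dep => y; apply: funext => p; exact: fg.
have Flt x w : lt x w -> F x <> F w.
  move=> xw; rewrite [F w]FE /step; case: cid => u /= h; exact: (h x xw).
exists F => x y e.
by case: (tot x y) => // /Flt; rewrite e.
Qed.

Lemma wellorder_inj W V (lt : W -> W -> Prop) (f : V -> W) : injective f ->
  wellorder lt -> wellorder (fun x y => lt (f x) (f y)).
Proof.
move=> injf [wf tot]; split.
  exact: Inverse_Image.wf_inverse_image.
move=> x y; case: (tot (f x) (f y)) => [|/injf|] h; first by constructor 1.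
  by constructor 2.
by constructor 3.
Qed.

(* Either the whole of W or its least initial segment that is too big. *)
Lemma short_wellorder W A : ~ card_le W A ->
  exists P : W -> Prop, exists lt : {x | P x} -> {x | P x} -> Prop,
  [/\ ~ card_le {x | P x} A, wellorder lt & forall w, card_le (segment lt w) A].
Proof.
move=> nWA; have [lt wlt] := wellorder_exists W.
have [bad|nbad] := pselect (exists w, ~ card_le (segment lt w) A).
  have [w [nw minw]] := wf_min (wo_wf wlt) bad.
  exists (fun x => lt x w), (fun x y => lt (sval x) (sval y)); split; first exact: nw.
    apply: (wellorder_inj _ wlt) => -[x p] [y q] /= e; exact: eq_exist.
  move=> [x p]; have /contrapT := minw x p; apply: card_le_trans.
  exists (fun z : segment (fun x0 y => lt (sval x0) (sval y)) (exist _ x p) =>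
     exist (fun t => lt t x) (sval (sval z)) (svalP z)).
  by move=> [[z1 ?] ?] [[z2 ?] ?] [/= e]; apply: eq_exist; apply: eq_exist.
exists (fun=> True), (fun x y => lt (sval x) (sval y)); split.
- move=> le; apply: nWA; apply: card_le_trans le.
  by exists (fun x => exist _ x I) => x y [].
- apply: (wellorder_inj _ wlt) => -[x p] [y q] /= e; exact: eq_exist.
move=> [x p]; have /contrapT : ~ ~ card_le (segment lt x) A.
  by move=> h; apply: nbad; exists x.
apply: card_le_trans.
exists (fun z : segment (fun x0 y => lt (sval x0) (sval y)) (exist _ x p) =>
   exist (fun t => lt t x) (sval (sval z)) (svalP z)).
by move=> [[z1 ?] ?] [[z2 ?] ?] [/= e]; apply: eq_exist; apply: eq_exist.
Qed.

Lemma card_le_total A B : ~ card_le B A -> card_le A B.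
Proof.
move=> nBA; have [lt wlt] := wellorder_exists A.
apply: (segments_card_le wlt) => w le; apply: nBA.
exact: card_le_trans le (card_le_sub _).
Qed.

Lemma cantor A : ~ card_le (A -> Prop) A.
Proof.
move=> [f injf]; pose D a := exists P, f P = a /\ ~ P a.
have : ~ D (f D) by move=> h; have [P [/injf -> ]] := h.
by move=> h; apply: (h); exists D.
Qed.

(** The successor of [A] is cut out of the power set of [A], as a well-order too big for [A] all of
    whose initial segments inject into [A]. A part that does not inject into [A] injects into no
    such segment, so the whole order injects into it. *)
Lemma isAleph_exists k : exists T : Type, isAleph k T.
Proof.
elim: k => [|k [A Ak]]; first by exists nat; exists id; exists id.
have [P [lt [nTA wlt segA]]] := short_wellorder (@cantor A).
exists {x | P x}; set T := ({x | P x}) in lt nTA wlt segA *.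
have [f injf] := card_le_total nTA.
have eA : card_eq A {t | exists a, f a = t}.
  exists (fun a => exist _ (f a) (ex_intro _ a erefl)); apply: inj_surj_bij.
    by move=> a a' [/injf].
  by move=> [t [a fa]]; exists a; apply: eq_exist.
exists (fun t => exists a, f a = t); split; first exact: isAleph_eq eA.
  move=> le; apply: nTA; apply: card_le_trans le _.
  exact/card_eq_le/card_eq_sym.
move=> B; have [le|nle] := pselect (card_le {x | B x} A).
  by left; apply: card_le_trans le (card_eq_le eA).
right; apply: card_le_antisym; first exact: card_le_sub.
apply: (segments_card_le wlt) => w le; apply: nle.
exact: card_le_trans le (segA w).
Qed.

Lemma card_le_prod A B C U : card_le A C -> card_le B U -> card_le (A * B) (C * U).
Proof.
move=> [f injf] [g injg]; exists (fun p => (f p.1, g p.2)).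
by move=> [a b] [a' b'] [/injf -> /injg ->].
Qed.

Lemma card_le_option A B : card_le A B -> card_le (option A) (option B).
Proof.
move=> [f injf]; exists (omap f) => -[a|] [a'|] //= [].
by move=> /injf ->.
Qed.

Lemma nat_le_aleph k T : isAleph k T -> card_le nat T.
Proof.
elim: k T => [|k IH] T /=; first by move=> /card_eq_sym /card_eq_le.
by move=> [A [/IH le _ _]]; apply: card_le_trans le (card_le_sub _).
Qed.

(** Hilbert's hotel: [None] takes the place of [f 0], and the copy of [nat] inside [A] is shifted by
    one. *)
Lemma card_le_option_inf A : card_le nat A -> card_le (option A) A.
Proof.
move=> [f injf].
pose g (o : option A) : A := match o with None => f 0 | Some a =>
  match pselect (exists m, f m = a) with
  | left h => f (sval (cid h)).+1 | right _ => a end end.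
exists g => -[a|] [a'|] //=.
- case: pselect => h; case: pselect => h'.
  + by case: cid => m /= em; case: cid => m' /= em' /injf [e]; rewrite -em -em' e.
  + by move=> e; case: h'; exists (sval (cid h)).+1.
  + by move=> e; case: h; exists (sval (cid h')).+1.
  + by move=> ->.
- case: pselect => h; first by move/injf.
  by move=> e; case: h; exists 0.
- case: pselect => h; first by move/injf.
  by move=> e; case: h; exists 0.
Qed.

(* Goedel's order on pairs: every initial segment lies in a square of a segment. *)
Lemma aleph_square k T : isAleph k T -> card_le (T * T) T.
Proof.
elim: k T => [|k IH] T.
  move=> /= TN; have [f [g fK gK]] := TN.
  exists (fun p => g (choice.pickle (f p.1, f p.2))) => -[x y] [x' y'].
  move=> /(can_inj gK) /(pcan_inj choice.pickleK) [] /(can_inj fK) -> /(can_inj fK) -> //.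
move=> /= [A [Ak nTA TB]]; have natA := nat_le_aleph Ak; have AA := IH _ Ak.
(* [T] is replaced by a subset of the same size with a well-order whose initial segments inject into
   [A], so that the induction hypothesis applies to their squares. *)
have [P [lt [nPA wlt seg]]] := short_wellorder nTA.
case: (TB P) => [//|PT].
suff le : card_le ({x | P x} * {x | P x}) {x | P x}.
  have [PTl TPl] := (card_eq_le PT, card_eq_le (card_eq_sym PT)).
  exact: card_le_trans (card_le_prod TPl TPl) (card_le_trans le PTl).
set W := ({x | P x}) in lt nPA wlt seg *.
have [wf tot] := wlt.
pose mx (p : W * W) := if pselect (lt p.1 p.2) then p.2 else p.1.
pose glt (p q : W * W) := lt (mx p) (mx q) \/
  mx p = mx q /\ (lt p.1 q.1 \/ p.1 = q.1 /\ lt p.2 q.2).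
have wgt : wellorder glt.
  split.
    have H m x y : forall p, mx p = m -> p.1 = x -> p.2 = y -> Acc glt p.
      elim/(well_founded_ind wf): m x y => m IHm.
      elim/(well_founded_ind wf) => x IHx; elim/(well_founded_ind wf) => y IHy p pm px py.
      constructor=> q [h|[e [h|[e1 h]]]].
      - by apply: (IHm (mx q)) => //; rewrite -pm.
      - by apply: (IHx q.1) => //; rewrite -?px // e pm.
      - by apply: (IHy q.2) => //; rewrite -?py // ?e ?pm // e1 px.
    by move=> p; apply: (H _ _ _ p).
  move=> [a b] [c d]; rewrite /glt /=.
  case: (tot (mx (a,b)) (mx (c,d))) => [h|e|h]; [by constructor 1; left| |by constructor 3; left].
  case: (tot a c) => [h|e1|h];
    [by constructor 1; right; split=> //; left| |by constructor 3; right; split=> //; left].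
  case: (tot b d) => [h|e2|h].
  - by constructor 1; right; split=> //; right.
  - by constructor 2; rewrite e1 e2.
  - by constructor 3; right; split=> //; right.
apply: (segments_card_le wgt) => w le; apply: nPA; apply: card_le_trans le _.
(* The coordinates of a pair below [w] may be equal to [mx w]; [None] stands for this value. *)
have [z z1] : exists z : option (segment lt (mx w)) -> {x | A x}, injective z.
  apply: card_le_trans (card_le_option (seg (mx w))) (card_le_option_inf natA).
have bnd (p : W * W) : glt p w -> (lt p.1 (mx w) \/ p.1 = mx w) /\ (lt p.2 (mx w) \/ p.2 = mx w).
  have tr x y t : lt x y -> lt y t -> lt x t.
    move=> xy yt; case: (tot x t) => // [e|tx].
      suff F : forall s u, lt s u -> lt u s -> False by case: (F x y); rewrite // e.
      by elim/(well_founded_ind wf) => s IHs u su us; exact: (IHs u us s us su).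
    suff F : forall s u v, lt s u -> lt u v -> lt v s -> False by case: (F x y t).
    elim/(well_founded_ind wf) => s IHs u v su uv vs; exact: (IHs v vs s u vs su uv).
  have m1 : lt p.1 (mx p) \/ p.1 = mx p by rewrite /mx; case: pselect => h; [left|right].
  have m2 : lt p.2 (mx p) \/ p.2 = mx p.
    rewrite /mx; case: pselect => h; first by right.
    by case: (tot p.1 p.2) => [//|e|lt21]; [right|left].
  case=> [h|[<- _] //]; split; left.
    by case: m1 => [m1|->] //; exact: tr m1 h.
  by case: m2 => [m2|->] //; exact: tr m2 h.
pose cd (x : W) : option (segment lt (mx w)) :=
  match pselect (lt x (mx w)) with left h => Some (exist _ x h) | right _ => None end.
have cd_inj x y : (lt x (mx w) \/ x = mx w) -> (lt y (mx w) \/ y = mx w) -> cd x = cd y -> x = y.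
  by rewrite /cd; case: pselect => h; case: pselect => h' //; [move=> _ _ []|move=> [|->] // [|->]].
apply: card_le_trans AA.
exists (fun p : segment glt w => (z (cd (sval p).1), z (cd (sval p).2))).
move=> [[a b] p] [[c d] q] /= [/z1 e1 /z1 e2].
have [/= a1 b1] := bnd _ p; have [/= c1 d1] := bnd _ q.
by apply: eq_exist; rewrite (cd_inj _ _ a1 c1 e1) (cd_inj _ _ b1 d1 e2).
Qed.

(** Lists are coded by iterated pairing; [f 0] and [f 1] tag the empty list and a nonempty one. *)
Lemma card_le_seq T : card_le nat T -> card_le (T * T) T -> card_le (seq T) T.
Proof.
move=> [f injf] [g injg].
pose enc := fix enc (s : seq T) : T :=
  if s is x :: s' then g (f 1, g (x, enc s')) else g (f 0, f 0).
exists enc; elim=> [|x s IH] [|y t] //= /injg.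
- by move=> [/injf].
- by move=> [/injf].
by move=> [/injg [-> /IH ->]].
Qed.

End Cardinals.

Local Open Scope fset_scope.

(** * Kuratowski's free set theorem *)

Section FreeSet.
Variable Z : choiceType.

Lemma nat_le_notin X (i : X -> Z) (l : seq Z) :
  injective i -> card_le nat X -> exists x, i x \notin l.
Proof.
move=> injI [f injf]; apply: contrapT => no.
have sub : {subset [seq i (f m) | m <- iota 0 (size l).+1] <= l}.
  move=> z /mapP[m _ ->]; apply: contrapT => /negP nin.
  by apply: no; exists (f m).
have : uniq [seq i (f m) | m <- iota 0 (size l).+1].
  by rewrite map_inj_uniq ?iota_uniq // => a b /injI /injf.
by move=> /uniq_leq_size /(_ sub); rewrite size_map size_iota ltnn.
Qed.

(* Kuratowski's theorem.  In the step a subset A of size aleph_k is taken, and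
   then a point outside A and outside all the F r with r a finite subset of A. *)
Lemma free_set k X (i : X -> Z) (F : {fset Z} -> Z -> Prop) :
  isAleph k X -> injective i ->
  (forall r, exists l : seq Z, forall z, F r z -> z \in l) ->
  exists s : {fset Z}, [/\ forall z, z \in s -> exists x, i x = z, #|` s| = k.+1 &
    forall c, c \in s -> ~ F (s `\ c) c].
Proof.
elim: k X i F => [|k IH] X i F Xk injI finF.
  have [l lP] := finF fset0.
  have [x xl] := nat_le_notin l injI (nat_le_aleph Xk).
  exists [fset i x]; split; rewrite ?cardfs1 //.
    by move=> z /fset1P ->; exists x.
  move=> c /fset1P ->; have -> : [fset i x] `\ i x = fset0 by rewrite fsetDv.
  by move=> /lP; apply/negP.
have [A [Ak nXA _]] := Xk.
have natA := nat_le_aleph Ak; have AA := aleph_square Ak.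
have [l lP] := ex_choice finF.
pose iA (a : {x | A x}) := i (sval a).
have injA : injective iA by move=> [a p] [b q] /injI /= e; apply: eq_exist.
have [f0 _] := natA; pose d0 := iA (f0 0).
have seqA (r : seq Z) : (forall z, z \in r -> exists a, iA a = z) -> exists r', r = map iA r'.
  elim: r => [|z r IHr] rA; first by exists [::].
  have [|r' ->] := IHr.
    by move=> z0 z0r; apply: rA; rewrite inE z0r orbT.
  have [|a <-] := rA z; first by rewrite inE eqxx.
  by exists (a :: r').
(* Otherwise [X] would inject into [A]: a point of [A] codes itself, and any other point is coded by
   a finite list of members of [A] together with its position in the list that bounds [F]. Such
   codes inject into [A] because [A * A] does. *)
have [x nAx xF] : exists2 x, ~ A x &
    forall r : {fset Z}, (forall z, z \in r -> exists a, iA a = z) -> ~ F r (i x).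
  apply: contrapT => no; apply: nXA.
  pose codes x (c : {x | A x} + seq {x | A x} * nat) :=
    match c with
    | inl a => sval a = x
    | inr p => nth d0 (l [fset z in map iA p.1]) p.2 = i x
    end.
  have cov x : exists c, codes x c.
    have [Ax|nAx] := pselect (A x); first by exists (inl (exist _ x Ax)).
    have [r [rA Frx]] : exists r : {fset Z}, (forall z, z \in r -> exists a, iA a = z) /\ F r (i x).
      apply: contrapT => none; apply: no; exists x => // r rA Frx.
      by apply: none; exists r.
    have [r' er'] := seqA _ rA.
    have er : r = [fset z in map iA r'] by apply/fsetP => z; rewrite !inE /= -er'.
    exists (inr (r', index (i x) (l r))); rewrite /codes /= -er.
    by rewrite nth_index //; exact: lP.
  have [h hP] := ex_choice cov.
  have injh : injective h.
    move=> x y e; move: (hP x) (hP y); rewrite e.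
    case: (h y) => [a|p] /=; first by move=> -> ->.
    by move=> -> /injI.
  apply: card_le_trans (ex_intro _ h injh) _; apply: card_le_trans (AA).
  have [e2 inje2] : card_le (seq {x | A x} * nat) {x | A x}.
    apply: card_le_trans (AA); apply: card_le_prod => //; exact: card_le_seq.
  have [e1 inje1] := natA.
  exists (fun c => match c with inl a => (e1 0, a) | inr p => (e1 1, e2 p) end).
  move=> [a|p] [b|q] [].
  - by move=> ->.
  - by move=> /inje1.
  - by move=> /inje1.
  - by move=> /inje2 ->.
have ixA (r : {fset Z}) : (forall z, z \in r -> exists a, iA a = z) -> i x \notin r.
  by move=> rA; apply/negP => /rA[[a Aa] /injI /= e]; apply: nAx; rewrite -e.
(* With [i x] frozen into the first argument of [F], the smaller set stays free after [i x] is
   added; freeness at [i x] itself is the choice of [x]. *)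
have [|s [sA cs free]] := IH _ iA (fun r z => F (i x |` r) z) Ak injA.
  by move=> r; exact: finF.
exists (i x |` s); split.
- move=> z /fset1UP[->|/sA[a <-]]; first by exists x.
  by exists (sval a).
- by rewrite cardfsU1 (ixA _ sA) cs.
move=> c /fset1UP[->|cs']; first by rewrite fsetU1K ?ixA //; exact: xF.
have -> : (i x |` s) `\ c = i x |` (s `\ c); last exact: free.
apply/fsetP => z; rewrite !inE; case: (eqVneq z (i x)) => [->|//]; rewrite orTb andbT.
by apply: contraTneq cs' => <-; exact: ixA.
Qed.

End FreeSet.

(** * Standard models *)

Lemma In_mem (T : eqType) (x : T) (s : seq T) : List.In x s <-> x \in s.
Proof.
elim: s => [|y s IH] //=; rewrite inE IH.
by split=> [[->|->]|/orP[/eqP->|]]; rewrite ?eqxx ?orbT //; [left|right].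
Qed.

Lemma In_map (A B : Type) (f : A -> B) (b : B) (s : seq A) :
  List.In b (map f s) <-> exists a, List.In a s /\ f a = b.
Proof.
elim: s => [|x s IH] /=; first by split=> // -[? []].
rewrite IH; split=> [[<-|[a [sa <-]]]|[a [[->|sa] fa]]].
- by exists x; split=> //; left.
- by exists a; split=> //; right.
- by left.
- by right; exists a.
Qed.

(** * Facets of an (n+1)-set *)

Section Simplices.
Variables (n : nat) (T : choiceType).

Definition nset := {u : {fset T} | #|` u| == n}.

Lemma card_nset (u : nset) : #|` val u| = n.
Proof. exact/eqP/(valP u). Qed.

(* The n-subsets of the (n+1)-set w other than v, in some order. *)
Definition simplex (us : 'I_n -> nset) (v : nset) (w : {fset T}) : Prop :=
  [/\ #|` w| = n.+1, forall l, val (us l) `<=` w, val v `<=` w, injective us &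
      forall l, us l <> v].

Lemma fset_enum_ord (w : {fset T}) m : #|` w| = m ->
  exists f : 'I_m -> T, injective f /\ forall z, z \in w <-> exists j, f j = z.
Proof.
move=> cw; pose t : m.-tuple T := @Tuple m T (enum_fset w) (introT eqP cw).
exists (tnth t); split; first by apply/tuple_uniqP; exact: fset_uniq.
move=> z; split=> [zw|[i <-]]; last exact: (mem_tnth i t).
have /tnthP[i ->] : z \in t by [].
by exists i.
Qed.

Lemma fset_of_ord m (f : 'I_m -> T) : injective f ->
  exists w : {fset T}, #|` w| = m /\ forall z, z \in w <-> exists j, f j = z.
Proof.
move=> injf; exists [fset f j | j in 'I_m]; split.
  by rewrite card_imfset //= -cardE card_ord.
move=> z; split=> [/imfsetP[j _ ->]|[j <-]]; first by exists j.
by apply/imfsetP; exists j.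
Qed.

(** By cardinality [us l] misses just one point of [w]; were this point outside [v], then [v] would
    be contained in [us l] and hence equal to it. *)
Lemma simplex_facet us v w l : simplex us v w ->
  exists2 z, z \in val v & val (us l) = w `\ z.
Proof.
move=> [cw usw vw injus nus].
have /eqP/cardfs1P[z ez] : #|` w `\` val (us l)| = 1.
  by rewrite cardfsDS // cw card_nset subSnn.
have eu : val (us l) = w `\ z by rewrite -ez fsetDK.
exists z => //; apply: contrapT => /negP zv; apply: (nus l); apply: val_inj.
apply/esym/eqP; rewrite eqEfcard !card_nset leqnn andbT eu.
by rewrite fsubsetD1 vw zv.
Qed.

(** The [us l] are n distinct sets among the n sets obtained by removing a point of [v] from [w], so
    they exhaust them. *)
Lemma simplex_facets us v w z : simplex us v w -> z \in val v ->
  exists l, val (us l) = w `\ z.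
Proof.
move=> Sw zv; have [cw usw vw injus nus] := Sw.
have u1 : uniq [seq val (us l) | l : 'I_n].
  by rewrite map_inj_uniq ?enum_uniq //; apply: inj_comp val_inj injus.
have [||_ e] := uniq_min_size u1 (s2 := [seq w `\ z | z <- enum_fset (val v)]).
- move=> u /mapP[l _ ->]; have [z' z'v ->] := simplex_facet l Sw.
  by apply/mapP; exists z'.
- by rewrite size_map -[size (enum_fset _)]/(#|` _|) card_nset size_map size_enum_ord.
have : w `\ z \in [seq w `\ z | z <- enum_fset (val v)] by apply/mapP; exists z.
by rewrite -e => /mapP[l _ ->]; exists l.
Qed.

(** Both families list the facets other than [v]. With the symmetry of [Q], truth values on base
    points are thus independent of the listing. *)
Lemma simplex_perm us us' v w : simplex us v w -> simplex us' v w ->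
  exists2 sigma : 'I_n -> 'I_n, injective sigma & forall l, us' l = us (sigma l).
Proof.
move=> Sw Sw'.
have /ex_choice[sigma sP] l : exists l', us' l = us l'.
  have [z zv e] := simplex_facet l Sw'.
  have [l' e'] := simplex_facets Sw zv.
  by exists l'; apply: val_inj; rewrite e e'.
exists sigma => // l l' e; have [_ _ _ inj' _] := Sw'.
by apply: inj'; rewrite !sP e.
Qed.

Lemma simplex_join us v w l : simplex us v w -> w = val v `|` val (us l).
Proof.
move=> Sw; have [z zv ->] := simplex_facet l Sw; have [_ _ vw _ _] := Sw.
apply/fsetP => x; rewrite !inE; case: eqP => [->|_] /=.
  by rewrite zv (fsubsetP vw).
by case: (boolP (x \in val v)) => // /(fsubsetP vw) ->.
Qed.

Lemma simplex_exists (v : nset) (w : {fset T}) :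
  #|` w| = n.+1 -> val v `<=` w -> exists us, simplex us v w.
Proof.
move=> cw vw; have [f [injf fP]] := fset_enum_ord (card_nset v).
have fv l : f l \in val v by apply/fP; exists l.
have cu l : #|` w `\ f l| == n.
  by have := cardfsD1 (f l) w; rewrite cw (fsubsetP vw _ (fv l)) add1n => -[->].
exists (fun l => Sub (w `\ f l) (cu l)); split=> //.
- by move=> l; rewrite SubK fsubD1set.
- move=> l l' /(congr1 val); rewrite !SubK => /fsetP /(_ (f l)).
  rewrite !inE eqxx /= (fsubsetP vw _ (fv l)) andbT => /esym/negbFE/eqP/injf //.
by move=> l /(congr1 val); rewrite SubK => e; have := fv l; rewrite -e !inE eqxx.
Qed.

End Simplices.

Section NMap.
Variables (n : nat) (T J : choiceType) (j : T -> J) (jinj : injective j).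

Lemma nmap_subproof (u : nset n T) : #|` [fset j x | x in val u]| == n.
Proof. by rewrite card_imfset // card_nset. Qed.

Definition nmap (u : nset n T) : nset n J :=
  exist (fun x : {fset J} => is_true (#|` x| == n)) _ (nmap_subproof u).

Lemma mem_nmap u z : z \in val (nmap u) <-> exists2 t, t \in val u & j t = z.
Proof.
rewrite /=; split=> [/imfsetP[t /= tu ->]|[t tu <-]]; first by exists t.
exact: in_imfset.
Qed.

Lemma nmap_inj : injective nmap.
Proof.
move=> u u' e; apply: val_inj; apply/fsetP => t; apply/idP/idP => tu.
  have /mem_nmap[t' t'u /jinj <- //] : j t \in val (nmap u').
  by rewrite -e; apply/mem_nmap; exists t.
have /mem_nmap[t' t'u /jinj <- //] : j t \in val (nmap u).
by rewrite e; apply/mem_nmap; exists t.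
Qed.

Lemma simplex_nmap us v w : simplex us v w ->
  simplex (fun l => nmap (us l)) (nmap v) [fset j x | x in w].
Proof.
move=> [cw usw vw injus nus]; split.
- by rewrite card_imfset.
- move=> l; apply/fsubsetP => z /mem_nmap[t tu <-].
  by apply: in_imfset; apply: (fsubsetP (usw l)).
- apply/fsubsetP => z /mem_nmap[t tu <-].
  by apply: in_imfset; apply: (fsubsetP vw).
- by move=> l l' /nmap_inj /injus.
- by move=> l /nmap_inj; apply: nus.
Qed.

End NMap.

Section Compat.
Variable n : nat.
Hypothesis n_gt0 : 0 < n.

Definition compatK (M : struc n) (us : 'I_n -> sK M) (v : sK M) : Prop :=
  exists w : 'I_n.+1 -> sI M,
    [/\ injective w, forall l z, Defs.mem z (us l) -> exists j, w j = z,
        forall z, Defs.mem z v -> exists j, w j = z, injective us & forall l, us l <> v].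

Lemma compatK_simplex (M : struc n) (T : choiceType) (i : T -> sI M) (iK : nset n T -> sK M)
    (us : 'I_n -> nset n T) (v : nset n T) : injective i ->
    (forall u z, Defs.mem z (iK u) <-> exists2 t, t \in val u & i t = z) ->
  compatK (fun l => iK (us l)) (iK v) <-> exists w, simplex us v w.
Proof.
move=> injI memK.
have injK : injective iK.
  move=> u u' e; apply: val_inj; apply/fsetP => t; apply/idP/idP => tu.
    by have /memK[t' ? /injI <-] : Defs.mem (i t) (iK u') by rewrite -e; apply/memK; exists t.
  by have /memK[t' ? /injI <-] : Defs.mem (i t) (iK u) by rewrite e; apply/memK; exists t.
split; last first.
  move=> [w [cw usw vw injus nus]]; have [f [injf fP]] := fset_enum_ord cw.
  exists (i \o f); split.
  - exact: inj_comp.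
  - move=> l z /memK[t tu <-]; have /fP[j <-] := fsubsetP (usw l) _ tu.
    by exists j.
  - move=> z /memK[t tu <-]; have /fP[j <-] := fsubsetP vw _ tu.
    by exists j.
  - by move=> l l' /injK /injus.
  - by move=> l /injK; apply: nus.
move=> [w [injw usw vw injus nus]].
(* Two distinct facets already span the (n+1)-set, so [W] is the only candidate. It has more than n
   points and injects into ['I_n.+1] by [jf], so [jf] is onto. *)
pose l0 : 'I_n := Ordinal n_gt0; pose W := val v `|` val (us l0).
have Ww t : t \in W -> exists j, w j = i t.
  by rewrite inE => /orP[tu|tu]; [apply: vw|apply: (usw l0)]; apply/memK; exists t.
have /ex_choice[jf jfP] t : exists j, t \in W -> w j = i t.
  have [/Ww[j wj]|_] := boolP (t \in W); first by exists j.
  by exists ord0.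
have injj : {in W &, injective jf}.
  by move=> t t' tW t'W /(congr1 w); rewrite !jfP // => /injI.
have uj : uniq (map jf (enum_fset W)) by rewrite map_inj_in_uniq ?fset_uniq.
have cWge : n < #|` W|.
  rewrite -(card_nset v); apply: fproper_ltn_card; rewrite fproperEneq fsubsetUl andbT.
  apply/eqP => eW; apply: (nus l0); congr iK; apply/val_inj/eqP.
  by rewrite eqEfcard !card_nset leqnn andbT eW fsubsetUr.
have [||eW eWm] := uniq_min_size uj (s2 := enum 'I_n.+1).
- by move=> ? _; rewrite mem_enum.
- by rewrite (size_map jf) size_enum_ord.
exists W; split.
- by rewrite -[LHS](size_map jf) eW size_enum_ord.
- move=> l; apply/fsubsetP => t tu.
  have [|j wj] := usw l (i t); first by apply/memK; exists t.
  have : j \in map jf (enum_fset W) by rewrite eWm mem_enum.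
  by move=> /mapP[t' t'W ej]; move: wj; rewrite ej jfP // => /injI <-.
- exact: fsubsetUl.
- by move=> l l' e; apply: injus; rewrite /= e.
- by move=> l e; apply: (nus l); rewrite e.
Qed.

End Compat.

Section Model.
Variables (n : nat) (T : choiceType) (eps : {fset T} -> {fset T} -> bool).
Hypothesis n_gt0 : 0 < n.

Definition symdiff (S : choiceType) (g h : {fset S}) : {fset S} := (g `\` h) `|` (h `\` g).

Lemma mem_symdiff (S : choiceType) (g h : {fset S}) z :
  (z \in symdiff g h) = (z \in g) (+) (z \in h).
Proof. by rewrite !inE; case: (z \in g); case: (z \in h). Qed.

(* The model on the index set T with a chosen base point in every stalk:
   G^* = K x G and H^* = K x Z_2.  Whether Q holds on the base points of the
   stalks of an (n+1)-set w, with v as last stalk, is prescribed by eps w v. *)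
Definition stdQ (x : 'I_n -> nset n T * {fset nset n T}) (y : nset n T * bool) : Prop :=
  exists2 w, simplex (fun l => (x l).1) y.1 w &
    (\big[addb/false]_l (y.1 \in (x l).2)) (+) y.2 = eps w (val y.1).

Definition std : struc n :=
  @Struc n T (nset n T) bool {fset nset n T} (nset n T * {fset nset n T}) (nset n T * bool)
    (fun z u => is_true (z \in val u)) false addb fset0 (@symdiff _)
    (fun g u => u \in g) (fun g u => is_true (u \in g))
    fst (fun g x => (x.1, symdiff g x.2)) fst (fun m y => (y.1, m (+) y.2)) stdQ.

Lemma foldr_addb (b : 'I_n -> bool) m :
  foldr (fun l acc => b l (+) acc) m (enum 'I_n) = (\big[addb/false]_l b l) (+) m.
Proof.
rewrite -big_enum /=; elim: (enum 'I_n) => [|l s IH] /=; first by rewrite big_nil.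
by rewrite big_cons IH addbA.
Qed.

Lemma std_compat (x : 'I_n -> sGs std) (y : sHs std) :
  compatible x y <-> exists w, simplex (fun l => (x l).1) y.1 w.
Proof.
apply: (@compatK_simplex n n_gt0 std T id id (fun l => (x l).1) y.1) => // u z.
by split=> [zu|[t tu <-]] //; exists z.
Qed.

Lemma simplex_uniq us v w w' : @simplex n T us v w -> simplex us v w' -> w = w'.
Proof.
by move=> S S'; rewrite (simplex_join (Ordinal n_gt0) S) (simplex_join (Ordinal n_gt0) S').
Qed.

Lemma std_inKn : inKn std.
Proof.
have nP (u v : nset n T) : (forall z, z \in val u <-> z \in val v) -> u = v.
  move=> h; apply: val_inj; apply/fsetP => z.
  by apply/idP/idP; case: (h z).
have fs (h : nset n T -> bool) : (exists l : list (nset n T), forall u, h u <> false -> List.In u l) ->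
    exists g : {fset nset n T}, forall u, (u \in g) = h u.
  move=> [l lP]; exists [fset u in l | h u] => u; rewrite !inE /=.
  case: (boolP (h u)) => hu; rewrite ?andbF // andbT.
  by apply/In_mem/lP; rewrite hu.
have sP (g g' : {fset nset n T}) : (forall u, (u \in g) = (u \in g')) -> g = g'.
  by move=> h; apply/fsetP.
split=> //=.
- move=> u; exact: fset_enum_ord (card_nset u).
- move=> f /fset_of_ord[w [cw wP]].
  by exists (exist (fun x : {fset T} => is_true (#|` x| == n)) w (introT eqP cw)).
- by exists true; split=> //; case; [right|left].
- by move=> a b u; rewrite mem_symdiff.
- by move=> a; exists (enum_fset a) => u ua; apply/In_mem; case: (u \in a) ua.
- by move=> a u; case: (u \in a); split.
- by move=> u; exists (u, fset0).
- by move=> [u g] /=; congr pair; apply: sP => v; rewrite mem_symdiff inE.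
- by move=> a b [u g] /=; congr pair; apply: sP => v; rewrite !mem_symdiff addbA.
- move=> [u g] [v h] /= ->; exists (symdiff h g); congr pair; apply: sP => w.
  by rewrite !mem_symdiff -addbA addbb addbF.
- move=> a b [u g] [] e; apply: sP => v; have /fsetP/(_ v) := e.
  by rewrite !mem_symdiff => /addIb.
- by move=> u; exists (u, false).
- by move=> [u b].
- by move=> m m' [u b] /=; rewrite addbA.
- by move=> [u b] [v c] /= ->; exists (c (+) b); rewrite -addbA addbb addbF.
- by move=> m m' [u b] [] /addIb.
- have sym sigma x y : injective sigma -> stdQ x y -> stdQ (fun l => x (sigma l)) y.
    move=> injs [w [cw usw vw injus nus] e]; exists w.
      by split=> // l l' /injus /injs.
    rewrite -e; congr addb; rewrite [RHS](reindex_inj injs); exact: eq_bigr.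
  move=> sigma injs x y; split; last exact: sym.
  have [tau st ts] := injF_bij injs.
  move=> /(sym tau _ _ (can_inj ts)); congr stdQ; apply: funext => l.
  by rewrite ts.
- by move=> x y [w Sw _]; apply/std_compat; exists w.
move=> x y /std_compat[w Sw] gam m.
(* Over fixed stalks [Q] is a linear equation over Z_2, so a shift preserves its truth value exactly
   when the total shift is zero. *)
have QE x' y' : (forall l, (x' l).1 = (x l).1) -> y'.1 = y.1 ->
    stdQ x' y' <-> (\big[addb/false]_l (y'.1 \in (x' l).2)) (+) y'.2 = eps w (val y.1).
  move=> ex ey; rewrite /stdQ; have -> : (fun l => (x' l).1) = (fun l => (x l).1) by apply: funext.
  rewrite ey; split=> [[w' Sw' e]|e]; last by exists w.
  by rewrite (simplex_uniq Sw Sw').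
rewrite !QE //= /hsum /= foldr_addb.
rewrite (eq_bigr (fun l => (y.1 \in gam l) (+) (y.1 \in (x l).2))); last first.
  by move=> l _; rewrite mem_symdiff.
rewrite big_split /=.
case: (\big[addb/false]_l (y.1 \in gam l)); case: (\big[addb/false]_l (y.1 \in (x l).2));
  case: (y.2); case: m; case: (eps _ _);
  by split=> //= -[h1 h2]; (try by have := h1 erefl); (try by have := h2 erefl).
Qed.

End Model.

(** * Embeddings and charts *)

Section Embeddings.
Variable n : nat.
Hypothesis n_gt0 : 0 < n.
Implicit Types M N : struc n.

(* The last clause says that the support of f a lies in the image of f; it is
   not atomic, but it is preserved by L_(omega_1,omega)-elementary maps. *)
Record embedding M N (f : emb M N) : Prop := Embedding {
  em_inj : forall s, injective (f s);
  em_mem : forall z u, Defs.mem (f SI z) (f SK u) <-> Defs.mem z u;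
  em_h0 : f SH (hzero M) = hzero N;
  em_hadd : forall a b, f SH (hadd a b) = hadd (f SH a : sH N) (f SH b);
  em_g0 : f SG (gzero M) = gzero N;
  em_gadd : forall a b, f SG (gadd a b) = gadd (f SG a : sG N) (f SG b);
  em_ev : forall a u, f SH (ev a u) = ev (f SG a : sG N) (f SK u);
  em_supp : forall a u, supp (f SG a : sG N) (f SK u) <-> supp a u;
  em_pG : forall x, f SK (pG x) = pG (f SGs x : sGs N);
  em_actG : forall a x, f SGs (actG a x) = actG (f SG a : sG N) (f SGs x);
  em_pH : forall y, f SK (pH y) = pH (f SHs y : sHs N);
  em_actH : forall m y, f SHs (actH m y) = actH (f SH m : sH N) (f SHs y);
  em_Q : forall x y, @Q n N (fun l => f SGs (x l)) (f SHs y) <-> Q x y;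
  em_ev_im : forall a U, ev (f SG a : sG N) U <> hzero N -> exists u, f SK u = U
}.

Definition emb_comp M N P (g : emb N P) (f : emb M N) : emb M P := fun s c => g s (f s c).

Lemma embedding_comp M N P (g : emb N P) (f : emb M N) :
  embedding g -> embedding f -> embedding (emb_comp g f).
Proof.
move=> Eg Ef; rewrite /emb_comp; split.
- by move=> s x y /(em_inj Eg) /(em_inj Ef).
- by move=> z u; rewrite (em_mem Eg) (em_mem Ef).
- by rewrite (em_h0 Ef) (em_h0 Eg).
- by move=> a b; rewrite (em_hadd Ef) (em_hadd Eg).
- by rewrite (em_g0 Ef) (em_g0 Eg).
- by move=> a b; rewrite (em_gadd Ef) (em_gadd Eg).
- by move=> a b; rewrite (em_ev Ef) (em_ev Eg).
- by move=> a b; rewrite (em_supp Eg) (em_supp Ef).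
- by move=> x; rewrite (em_pG Ef) (em_pG Eg).
- by move=> a x; rewrite (em_actG Ef) (em_actG Eg).
- by move=> x; rewrite (em_pH Ef) (em_pH Eg).
- by move=> a x; rewrite (em_actH Ef) (em_actH Eg).
- by move=> x y; rewrite (em_Q Eg) (em_Q Ef).
move=> a U evU; have [V eV] := em_ev_im Eg evU; subst U.
have [|u <-] := em_ev_im Ef (a := a) (U := V); last by exists u.
by move=> e; apply: evU; rewrite -(em_ev Eg) e (em_h0 Eg).
Qed.

Lemma embedding_inv M N (f : emb M N) (g : emb N M) :
  embedding f -> (forall s c, f s (g s c) = c) -> embedding g.
Proof.
move=> Ef gK; have fK s c : g s (f s c) = c by apply: (em_inj Ef); rewrite gK.
split.
- by move=> s x y e; rewrite -(gK s x) e gK.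
- by move=> z u; rewrite -(em_mem Ef) !gK.
- by apply: (em_inj Ef); rewrite gK (em_h0 Ef).
- by move=> a b; apply: (em_inj Ef); rewrite (em_hadd Ef) !gK.
- by apply: (em_inj Ef); rewrite gK (em_g0 Ef).
- by move=> a b; apply: (em_inj Ef); rewrite (em_gadd Ef) !gK.
- by move=> a b; apply: (em_inj Ef); rewrite (em_ev Ef) !gK.
- by move=> a b; rewrite -(em_supp Ef) !gK.
- by move=> x; apply: (em_inj Ef); rewrite (em_pG Ef) !gK.
- by move=> a x; apply: (em_inj Ef); rewrite (em_actG Ef) !gK.
- by move=> x; apply: (em_inj Ef); rewrite (em_pH Ef) !gK.
- by move=> a x; apply: (em_inj Ef); rewrite (em_actH Ef) !gK.
- move=> x y; rewrite -(em_Q Ef) gK.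
  by have -> : (fun l => f SGs (g SGs (x l))) = x by apply: funext => l; rewrite gK.
- by move=> a U _; exists (f SK U); rewrite fK.
Qed.

(** The image of [u] has just n members, and the images of the n members of [u] are already that
    many. *)
Lemma embedding_members M N (f : emb M N) : inKn M -> inKn N -> embedding f ->
  forall (u : sK M) z, Defs.mem z (f SK u : sK N) <-> exists2 t, Defs.mem t u & f SI t = z.
Proof.
move=> KM KN Ef u z; split; last by move=> [t tu <-]; apply/(em_mem Ef).
have [h [injh hP]] := kn_members KM u; have [g [injg gP]] := kn_members KN (f SK u : sK N).
have /ex_choice[sg sgP] l : exists l', g l' = f SI (h l).
  by apply/gP/(em_mem Ef)/hP; exists l.
have injs : injective sg.
  by move=> l l' e; apply: injh; apply: (@em_inj _ _ _ Ef SI); rewrite -!sgP e.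
have [tau st ts] := injF_bij injs.
move=> /gP[l <-]; exists (h (tau l)); first by apply/hP; exists (tau l).
by rewrite -sgP ts.
Qed.

Section Charts.
Variables (T : choiceType) (eps : {fset T} -> {fset T} -> bool).
Let S : struc n := std n eps.

(** The standard model is generated by its index points and base points: base points project onto
    [K], stalks are their orbits, and the image of an element of [G] is known from its evaluations
    because its support stays inside the image of [K]. *)
Lemma std_emb_unique M (f g : emb S M) : inKn M -> embedding f -> embedding g ->
  (forall t, f SI t = g SI t) ->
  (forall u, f SGs (u, fset0) = g SGs (u, fset0)) ->
  (forall u, f SHs (u, false) = g SHs (u, false)) ->
  forall s c, f s c = g s c.
Proof.
move=> KM Ef Eg eI eGs eHs.
have eH b : f SH b = g SH b.
  have [e [e0 eP _ _ _]] := kn_H KM.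
  have ff : f SH false = hzero M := em_h0 Ef.
  have gf : g SH false = hzero M := em_h0 Eg.
  case: b; last by rewrite ff gf.
  have fe : f SH true = e.
    by case: (eP (f SH true)) => //; rewrite -ff => h; have := @em_inj _ _ _ Ef SH _ _ h.
  by case: (eP (g SH true)) => [|->] //; rewrite -gf => h; have := @em_inj _ _ _ Eg SH _ _ h.
have eK u : f SK u = g SK u.
  rewrite -[u]/(@pG n S (u, fset0)) (em_pG Ef) (em_pG Eg).
  by congr pG; exact: eGs.
have eG a : f SG a = g SG a.
  apply: (kn_ev_inj KM) => U.
  have [[u <-]|nU] := pselect (exists u, f SK u = U).
    by rewrite -(em_ev Ef) eK -(em_ev Eg) eH.
  have [->|h] := pselect (ev (f SG a : sG M) U = hzero M); last first.
    by have /nU := em_ev_im Ef h.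
  have [->//|h] := pselect (ev (g SG a : sG M) U = hzero M).
  by have [u eu] := em_ev_im Eg h; case: nU; exists u; rewrite eK.
case=> //=.
- move=> [u a].
  have -> : (u, a) = @actG n S a (u, fset0).
    by congr pair; apply/fsetP => v; rewrite mem_symdiff inE addbF.
  by rewrite (em_actG Ef) (em_actG Eg) eG; congr actG; exact: eGs.
- move=> [u b].
  have -> : (u, b) = @actH n S b (u, false) by rewrite /= addbF.
  by rewrite (em_actH Ef) (em_actH Eg) eH; congr actH; exact: eHs.
Qed.

(** Any choice of index points, and of base points in the stalks over them, coordinatises a part of
    [M]. The value [false] of [eps] stands for truth of [Q], as [stdQ] at trivial coordinates
    compares an empty parity with [eps]. *)
Lemma chart M (i : T -> sI M) (x : nset n T -> sGs M) (y : nset n T -> sHs M) :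
  inKn M -> injective i ->
  (forall u z, Defs.mem z (pG (x u)) <-> exists2 t, t \in val u & i t = z) ->
  (forall u, pH (y u) = pG (x u)) ->
  (forall us v w, simplex us v w ->
     Q (fun l => x (us l)) (y v) <-> eps w (val v) = false) ->
  exists f : emb S M, [/\ embedding f, forall t, f SI t = i t,
    forall u, f SGs (u, fset0) = x u & forall u, f SHs (u, false) = y u].
Proof.
move=> KM injI memx pHy Qeps.
have [e [e0 eP h00 h0e [he0 hee]]] := kn_H KM.
pose iH (b : bool) := if b then e else hzero M.
have iHD a b : hadd (iH a) (iH b) = iH (a (+) b) by case: a; case: b.
have injH : injective iH by case; case=> //= /esym // /e0.
have iH0 b : (iH b = hzero M) <-> (b = false) by split=> [|->//]; case: b.
pose iK u := pG (x u).
have injK : injective iK.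
  move=> u u' eu; apply: val_inj; apply/fsetP => t; apply/idP/idP => tu.
    by have /memx[t' ? /injI <-] : Defs.mem (i t) (iK u') by rewrite -eu; apply/memx; exists t.
  by have /memx[t' ? /injI <-] : Defs.mem (i t) (iK u) by rewrite eu; apply/memx; exists t.
(* [iG g] takes the value [e] exactly on the image of [g] under [iK]; it exists because [g] is
   finite. *)
have /ex_choice[iG iGP] (g : {fset nset n T}) :
    exists a : sG M, forall U, ev a U = iH `[< exists2 v, v \in g & iK v = U >].
  apply: (kn_ev_surj KM); exists (map iK (enum_fset g)) => U.
  case: asboolP => //= -[v vg vU] _; apply/In_map; exists v; split=> //; exact/In_mem.
have evG g v : ev (iG g) (iK v) = iH (v \in g).
  rewrite iGP; congr iH; apply/asboolP/idP => [[v' v'g /injK <-] //|vg].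
  by exists v.
have evG0 g U : ev (iG g) U <> hzero M -> exists u, iK u = U.
  by rewrite iGP; case: asboolP => // -[v _ <-] _; exists v.
have injG : injective iG.
  by move=> g g' eg; apply/fsetP => v; apply: injH; rewrite -!evG eg.
have iG_ext a g : (forall v, ev a (iK v) = iH (v \in g)) ->
    (forall U, ev a U <> hzero M -> exists u, iK u = U) -> iG g = a.
  move=> av aU; apply: (kn_ev_inj KM) => U.
  have [[u <-]|nU] := pselect (exists u, iK u = U); first by rewrite av evG.
  have [->|h] := pselect (ev a U = hzero M); last by have /nU := aU _ h.
  by have [//|h] := pselect (ev (iG g) U = hzero M); have /nU := evG0 _ _ h.
have iG0 : iG fset0 = gzero M.
  by apply: iG_ext => [v|U]; rewrite (kn_ev_zero KM) ?inE.
have iGD g h : iG (symdiff g h) = gadd (iG g) (iG h).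
  apply: iG_ext => [v|U]; rewrite (kn_ev_add KM) ?evG ?iHD ?mem_symdiff // => ne.
  have [gU|/evG0//] := pselect (ev (iG g) U = hzero M).
  have [hU|/evG0//] := pselect (ev (iG h) U = hzero M).
  by case: ne; rewrite gU hU.
pose iGs (p : nset n T * {fset nset n T}) := actG (iG p.2) (x p.1).
pose iHs (p : nset n T * bool) := actH (iH p.2) (y p.1).
have pGs p : pG (iGs p) = iK p.1 by rewrite (kn_actG_stalk KM).
have pHs p : pH (iHs p) = iK p.1 by rewrite (kn_actH_stalk KM) pHy.
pose f : emb S M := fun s =>
  match s return car S s -> car M s with
  | SI => i | SK => iK | SH => iH | SG => iG | SGs => iGs | SHs => iHs end.
exists f; split=> //=; last 2 first.
- by move=> u; rewrite /iGs /= iG0 (kn_actG_zero KM).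
- by move=> u; rewrite /iHs /= (kn_actH_zero KM).
have Smem u z : Defs.mem z (iK u) <-> exists2 t, t \in val u & i t = z := memx u z.
split=> //=.
- case=> //=.
  + move=> [u g] [u' g'] ep; have /= eu := congr1 (@pG n M) ep.
    rewrite !pGs /= in eu; move/injK: eu => eu; subst u'.
    by have /= -> := injG _ _ (kn_actG_free KM ep).
  + move=> [u g] [u' g'] ep; have /= eu := congr1 (@pH n M) ep.
    rewrite !pHs /= in eu; move/injK: eu => eu; subst u'.
    by have /= -> := injH _ _ (kn_actH_free KM ep).
- move=> z u; rewrite Smem; split=> [[t tu /injI <-] //|zu].
  by exists z.
- by move=> a u; rewrite (kn_supp KM) evG; case: (u \in a); split.
- by move=> a [u g] /=; rewrite /iGs /= iGD (kn_actG_add KM).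
- by move=> a [u g] /=; rewrite /iHs /= -iHD (kn_actH_add KM).
move=> x' y'.
have compat : compatible (fun l => iGs (x' l)) (iHs y') <->
    exists w, simplex (fun l => (x' l).1) y'.1 w.
  rewrite -(compatK_simplex n_gt0 _ _ injI Smem).
  have -> : (fun l => iK (x' l).1) = (fun l => pG (iGs (x' l))).
    by apply: funext => l; rewrite pGs.
  by rewrite -pHs.
(* [D] is the total displacement from the base points, read at the last stalk index; by the action
   axiom it decides whether [Q] has the same value as on the base points. *)
pose D := (\big[addb/false]_l (y'.1 \in (x' l).2)) (+) y'.2.
have QD w : simplex (fun l => (x' l).1) y'.1 w ->
    Q (fun l => iGs (x' l)) (iHs y') <-> D = eps w (val y'.1).
  move=> Sw; have Qb := Qeps _ _ _ Sw.
  have cb : compatible (fun l => x (x' l).1) (y y'.1).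
    have : compatK (fun l => pG (iGs (x' l))) (pH (iHs y')) by apply/compat; exists w.
    have -> : (fun l => pG (iGs (x' l))) = (fun l => pG (x (x' l).1)).
      by apply: funext => l; rewrite pGs.
    by rewrite pHs -[iK y'.1]pHy.
  have := kn_Q_act KM cb (fun l => iG (x' l).2) (iH y'.2).
  have -> : hsum (fun l => iG (x' l).2) (pH (y y'.1)) (iH y'.2) = iH D.
    rewrite /D -foldr_addb /hsum pHy; elim: (enum 'I_n) => [//|l s IH] /=.
    by rewrite IH -/(iK _) evG iHD.
  rewrite iH0 Qb; set A := Q (fun l => iGs (x' l)) (iHs y') => QA.
  have {QA} : (A <-> eps w (val y'.1) = false) <-> D = false by [].
  case: D; case: (eps _ _) => -[h1 h2]; split=> // a.
  - by apply: contrapT => na; have : true = false by apply: h1.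
  - by have : true = false by apply: h1; split.
  - by have := (h2 erefl).1 a.
  - exact: (h2 erefl).2.
split.
  move=> Qx; have /compat[w Sw] := kn_Q_compat KM Qx.
  by exists w => //; apply/QD.
by move=> [w Sw eD]; apply/QD; first exact: Sw.
Qed.

End Charts.
End Embeddings.

Definition infinite_type (A : Type) : Prop := forall l : list A, exists x, ~ List.In x l.

(** * Extending charts by new index points *)

Section Extensions.
Variable n : nat.
Hypothesis n_gt1 : 1 < n.
Let n_gt0 : 0 < n := ltnW n_gt1.
Implicit Types M N : struc n.

Definition restricts (T J : choiceType) (j : T -> J) (e0 : {fset T} -> {fset T} -> bool)
    (e1 : {fset J} -> {fset J} -> bool) : Prop :=
  forall (w : {fset T}) (v : nset n T), #|` w| = n.+1 -> val v `<=` w ->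
    e1 [fset j x | x in w] [fset j x | x in val v] = e0 w (val v).

Definition base_emb (T J : choiceType) (j : T -> J) (jinj : injective j) e0 e1
    (f : emb (std n (T := T) e0) (std n (T := J) e1)) : Prop :=
  [/\ embedding f, forall t, f SI t = j t,
    forall u, f SGs (u, fset0) = (nmap jinj u, fset0) &
    forall u, f SHs (u, false) = (nmap jinj u, false)].

Lemma std_base_Q (T : choiceType) e us v w : simplex us v w ->
  stdQ (T := T) (n := n) e (fun l => (us l, fset0)) (v, false) <-> e w (val v) = false.
Proof.
move=> Sw; rewrite /stdQ /=; rewrite addbF big1 //; split=> [[w' Sw' ew]|ew].
  by rewrite (simplex_uniq n_gt0 Sw Sw') -ew.
by exists w.
Qed.

Lemma base_emb_exists (T J : choiceType) (j : T -> J) (jinj : injective j) e0 e1 :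
  restricts j e0 e1 ->
  exists f : emb (std n (T := T) e0) (std n (T := J) e1), base_emb jinj f.
Proof.
move=> re.
have [|||f [Ef fI fGs fHs]] := @chart n n_gt0 T e0 (std n e1) j
    (fun u => (nmap jinj u, fset0)) (fun u => (nmap jinj u, false)) (std_inKn _ n_gt0) jinj.
- by move=> u z; apply: (mem_nmap jinj).
- by [].
- move=> us v w Sw; apply: (iff_trans (std_base_Q e1 (simplex_nmap jinj Sw))).
  by have [cw _ vw _ _] := Sw; rewrite re.
by exists f; split.
Qed.

Lemma base_emb_comp_unique (T J : choiceType) (j : T -> J) (jinj : injective j) e0 e1 M
    (phi : emb (std n (T := T) e0) (std n (T := J) e1)) (f : emb (std n e1) M)
    (g : emb (std n e0) M) :
  inKn M -> base_emb jinj phi -> embedding f -> embedding g ->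
  (forall t, f SI (j t) = g SI t) ->
  (forall u, f SGs (nmap jinj u, fset0) = g SGs (u, fset0)) ->
  (forall u, f SHs (nmap jinj u, false) = g SHs (u, false)) ->
  forall s c, f s (phi s c) = g s c.
Proof.
move=> KM [Ep pI pGs pHs] Ef Eg fI fGs fHs.
apply: (std_emb_unique KM (embedding_comp Ef Ep) Eg) => c; rewrite /emb_comp.
- by rewrite pI.
- by rewrite pGs.
- by rewrite pHs.
Qed.

(** Over stalks coming from [T] the base points are dictated by [f], elsewhere they are arbitrary;
    [e1] then records [Q] on them. This serves both to add a single point and to coordinatise a
    whole model. *)
Lemma extend_chart (T J : choiceType) (j : T -> J) (jinj : injective j) e0 M
    (f : emb (std n (T := T) e0) M) (i : J -> sI M) :
  inKn M -> embedding f -> injective i -> (forall t, i (j t) = f SI t) ->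
  exists e1 (phi : emb (std n (T := T) e0) (std n (T := J) e1)) (g : emb (std n e1) M),
  [/\ restricts j e0 e1, base_emb jinj phi, embedding g, forall t, g SI t = i t &
      forall s c, g s (phi s c) = f s c].
Proof.
move=> KM Ef injI ij.
have KS := @std_inKn n T e0 n_gt0.
have /ex_choice[x xP] (U : nset n J) : exists x : sGs M,
    (forall z, Defs.mem z (pG x) <-> exists2 t, t \in val U & i t = z) /\
    (forall u, U = nmap jinj u -> x = f SGs (u, fset0)).
  have [[u ->]|nu] := pselect (exists u, U = nmap jinj u); last first.
    have [h [injh hP]] := fset_enum_ord (card_nset U).
    have [|k kP] := @kn_full n M KM (i \o h); first exact: inj_comp.
    have [x xk] := kn_pG_onto KM k; exists x; split; last by move=> u eU; case: nu; exists u.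
    move=> z; rewrite xk kP; split=> [[l <-]|[t /hP[l <-] <-]]; last by exists l.
    by exists (h l) => //; apply/hP; exists l.
  exists (f SGs (u, fset0)); split; last by move=> u' /nmap_inj ->.
  move=> z; rewrite -(em_pG Ef) (embedding_members KS KM Ef).
  split=> [[t tu <-]|[t' /mem_nmap[t tu <-] <-]]; last by exists t.
  by exists (j t) => //; apply/mem_nmap; exists t.
have /ex_choice[y yP] (U : nset n J) : exists y : sHs M, pH y = pG (x U) /\
    (forall u, U = nmap jinj u -> y = f SHs (u, false)).
  have [[u eU]|nu] := pselect (exists u, U = nmap jinj u); last first.
    have [y yk] := kn_pH_onto KM (pG (x U)); exists y; split=> //.
    by move=> u eU; case: nu; exists u.
  exists (f SHs (u, false)); split; last by move=> u'; rewrite eU => /nmap_inj ->.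
  by rewrite ((xP U).2 _ eU) -(em_pH Ef) -(em_pG Ef).
have xE u : x (nmap jinj u) = f SGs (u, fset0) := (xP _).2 _ erefl.
have yE u : y (nmap jinj u) = f SHs (u, false) := (yP _).2 _ erefl.
pose e1 (w v : {fset J}) := `[< exists us (v' : nset n J),
  [/\ val v' = v, simplex us v' w & ~ Q (fun l => x (us l)) (y v')] >].
have [|||g [Eg gI gGs gHs]] := @chart n n_gt0 J e1 M i x y KM injI.
- by move=> u z; rewrite (xP u).1.
- by move=> u; rewrite (yP u).1.
- move=> us v w Sw; split=> [Qx|].
    apply/asboolP => -[us' [v' [/val_inj ev Sw' nQ]]]; subst v'.
    have [sg injs sE] := simplex_perm Sw Sw'.
    apply: nQ; have -> : (fun l => x (us' l)) = (fun l => x (us (sg l))).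
      by apply: funext => l; rewrite sE.
    by apply/(kn_Q_sym KM injs (fun l => x (us l))).
  by move=> /asboolP ne; apply: contrapT => nQ; apply: ne; exists us, v.
have re : restricts j e0 e1.
  move=> w v cw vw; have [us Sw] := simplex_exists cw vw.
  have S' := simplex_nmap jinj Sw.
  have : stdQ e0 (fun l => (us l, fset0)) (v, false) <->
         stdQ e1 (fun l => (nmap jinj (us l), fset0)) (nmap jinj v, false).
    apply: (iff_trans (iff_sym (em_Q Ef (fun l => (us l, fset0)) (v, false)))).
    apply: (iff_trans _ (em_Q Eg (fun l => (nmap jinj (us l), fset0)) (nmap jinj v, false))).
    rewrite gHs yE; have -> // : (fun l => g SGs (nmap jinj (us l), fset0)) = (fun l => f SGs (us l, fset0)).
    by apply: funext => l; rewrite gGs xE.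
  move=> h; have := iff_trans (iff_sym (std_base_Q e0 Sw)) (iff_trans h (std_base_Q e1 S')).
  move=> /=.
  by case: (e0 _ _); case: (e1 _ _) => // -[h1 h2]; rewrite ?h1 ?h2.
have [phi bphi] := base_emb_exists jinj re.
exists e1, phi, g; split=> //.
apply: (base_emb_comp_unique KM bphi) => // u.
- by rewrite gI ij.
- by rewrite gGs xE.
- by rewrite gHs yE.
Qed.

Lemma option_fset (T : choiceType) (w : {fset option T}) : None \notin w ->
  exists w' : {fset T}, w = [fset Some x | x in w'].
Proof.
move=> Nw; exists [fset x in pmap id (enum_fset w)]; apply/fsetP => -[x|]; last first.
  by rewrite (negbTE Nw); apply/esym/imfsetP => -[].
rewrite mem_imfset /=; last by move=> ? ? [].
by rewrite inE /= mem_pmap map_id.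
Qed.

Lemma fset_of_finType (T : finType) (h : nset n T -> bool) :
  exists g : {fset nset n T}, forall u, (u \in g) = h u.
Proof.
pose all := [fset u in
  pmap (fun x : {fset T} => insub x : option (nset n T)) (enum_fset (fpowerset [fset x in T]))].
exists [fset u in all | h u] => u; rewrite !inE /= mem_pmap; apply: andb_idl => _.
apply/mapP; exists (val u); last by rewrite valK.
by rewrite fpowersetE; apply/fsubsetP => x _; rewrite inE.
Qed.

(* Changes of base points realise every prescription of Q on the simplices
   containing the new point: for each (w, v) exactly one facet of w, namely the
   one missing the chosen point c v of v, is moved in its v-coordinate. *)
Lemma change_eps (T : finType) e0 e1 e2 :
  restricts (@Some T) e0 e1 -> restricts (@Some T) e0 e2 ->
  exists f : emb (std n (T := option T) e1) (std n (T := option T) e2),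
  [/\ embedding f, forall t, f SI t = t,
   forall u, None \notin val u -> f SGs (u, fset0) = (u, fset0) &
   forall u, f SHs (u, false) = (u, false)].
Proof.
move=> r1 r2.
(* Such a point exists because n > 1. Being different from [None], it can be removed from a simplex
   through [None] without losing [None]. *)
have /ex_choice[c cP] (v : nset n (option T)) : exists c, c != None /\ c \in val v.
  have : 0 < #|` val v `\ None|.
    rewrite -ltnS; apply: leq_trans n_gt1 _.
    by rewrite -[X in X <= _](card_nset v) (cardfsD1 None (val v)); case: (_ \in _).
  rewrite cardfs_gt0 => /fset0Pn[c]; rewrite !inE => /andP[cN cv].
  by exists c.
pose d w v := e1 w v (+) e2 w v.
have d0 w (v : nset n (option T)) : #|` w| = n.+1 -> val v `<=` w -> None \notin w -> d w (val v) = false.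
  move=> cw vw Nw; have Nv : None \notin val v by apply: contra Nw; apply: (fsubsetP vw).
  have [w' ew] := option_fset Nw; have [v' ev] := option_fset Nv.
  have sinj : injective (@Some T) by move=> ? ? [].
  have cv' : #|` v'| == n by apply/eqP; have := card_nset v; rewrite ev card_imfset.
  pose v'' : nset n T := exist (fun x : {fset T} => is_true (#|` x| == n)) v' cv'.
  have cw' : #|` w'| = n.+1 by move: cw; rewrite ew card_imfset.
  have vw' : val v'' `<=` w'.
    apply/fsubsetP => t tv; have : Some t \in w by apply: (fsubsetP vw); rewrite ev; apply: in_imfset.
    by rewrite ew => /imfsetP[t' /= t'w [->]].
  have := r1 w' v'' cw' vw'; have := r2 w' v'' cw' vw'.
  by rewrite /d /= -ew -ev => -> ->; rewrite addbb.
(* Only base points in stalks through [None] are moved, so the old ones stay. Since [T] is finite,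
   every set of stalk indices is the support of an element of [G]. *)
have /ex_choice[g gP] (u : nset n (option T)) := fset_of_finType (fun v : nset n (option T) =>
  [&& None \in val u, val v `\` val u == [fset c v] & d (val v `|` val u) (val v)]).
have KS := @std_inKn n (option T) e2 n_gt0.
have [|||f [Ef fI fGs fHs]] := @chart n n_gt0 (option T) e1 (std n e2) id
    (fun u => (u, g u)) (fun u => (u, false)) KS (fun x y xy => xy).
- by move=> u z /=; split=> [zu|[t tu <-] //]; exists z.
- by [].
- move=> us v w Sw; have [cw usw vw injus nus] := Sw.
  have [cN cv] := cP v; have [l0 el0] := simplex_facets Sw cv.
  have sum : \big[addb/false]_l (v \in g (us l)) = d w (val v).
    rewrite (bigD1 l0) //= big1 ?addbF => [|l ll0]; last first.
      rewrite gP; have [z zv ez] := simplex_facet l Sw; rewrite ez.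
      have -> : val v `\` (w `\ z) = [fset z].
        apply/fsetP => t; rewrite !inE negb_and negbK.
        case: (eqVneq t z) => [->|_] /=; first by rewrite zv.
        by case: (boolP (t \in val v)) => [/(fsubsetP vw)->|]; rewrite ?andbF.
      case: eqP => [/fset1_inj zc|_]; rewrite ?andbF //.
      by case/eqP: ll0; apply: injus; apply: val_inj; rewrite ez zc el0.
    rewrite gP el0; have -> : val v `|` w `\ c v = w.
      by rewrite -el0 -(simplex_join l0 Sw).
    have -> : val v `\` (w `\ c v) = [fset c v].
      apply/fsetP => t; rewrite !inE negb_and negbK.
      case: (eqVneq t (c v)) => [->|_] /=; first by rewrite cv.
      by case: (boolP (t \in val v)) => [/(fsubsetP vw)->|]; rewrite ?andbF.
    rewrite eqxx /= !inE eq_sym cN /=.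
    by case: (boolP (None \in w)) => // /(d0 w v cw vw) ->.
  have -> : Q (s := std n e2) (fun l => (us l, g (us l))) (v, false) <-> d w (val v) = e2 w (val v).
    rewrite /= /stdQ /= addbF sum; split=> [[w' Sw' e]|e]; last by exists w.
    by rewrite (simplex_uniq n_gt0 Sw Sw') in e *.
  by rewrite /d; case: (e1 _ _); case: (e2 _ _).
exists f; split=> // u Nu; rewrite fGs; congr pair; apply/fsetP => v.
by rewrite gP (negbTE Nu).
Qed.

Lemma forth (T : finType) e0 e1 M (sinj : injective (@Some T))
    (phi : emb (std n (T := T) e0) (std n (T := option T) e1)) (f : emb (std n e0) M) :
  inKn M -> infinite_type (sI M) -> restricts (@Some T) e0 e1 ->
  base_emb sinj phi -> embedding f ->
  exists g : emb (std n e1) M, embedding g /\ forall s c, g s (phi s c) = f s c.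
Proof.
move=> KM infM r1 bphi Ef.
have [p np] := infM (map (f SI) (enum T)).
have pf t : f SI t <> p.
  by move=> e; apply: np; apply/In_map; exists t; split=> //; apply/In_mem; rewrite mem_enum.
pose i (o : option T) : sI M := if o is Some t then f SI t else p.
have injI : injective i.
  move=> [t|] [t'|] //= e; first by congr Some; exact: (@em_inj _ _ _ _ Ef SI).
    by case: (pf t).
  by case: (pf t').
have [//|e2 [phi2 [h [r2 bphi2 Eh hI hphi]]]] :=
  @extend_chart T (option T) (@Some T) sinj e0 M f i KM Ef injI.
have [k [Ek kI kGs kHs]] := change_eps r1 r2.
exists (emb_comp h k); split; first exact: embedding_comp.
apply: (base_emb_comp_unique KM bphi (embedding_comp Eh Ek) Ef) => u; rewrite /emb_comp.
- by rewrite kI hI.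
- rewrite kGs; first by rewrite -hphi; case: bphi2 => _ _ -> _.
  by apply/negP => /mem_nmap[].
- by rewrite kHs -hphi; case: bphi2 => _ _ _ ->.
Qed.

End Extensions.

(** * Elementarity of embeddings *)

Lemma inj_preim_list (A B : Type) (f : A -> B) (l : list B) : injective f ->
  exists l', forall a, List.In (f a) l -> List.In a l'.
Proof.
move=> injf; elim: l => [|b l [l' IH]]; first by exists nil.
have [[a0 fa0]|na] := pselect (exists a, f a = b).
  exists (a0 :: l') => a /= [fa|/IH]; last by right.
  by left; apply: injf; rewrite fa0.
by exists l' => a /= [fa|/IH //]; case: na; exists a.
Qed.

Section Images.
Variable n : nat.
Hypothesis n_gt1 : 1 < n.
Let n_gt0 : 0 < n := ltnW n_gt1.
Variables (T : choiceType) (e : {fset T} -> {fset T} -> bool) (M : struc n).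
Variable f : emb (std n e) M.
Arguments f : clear implicits.
Hypotheses (KM : inKn M) (Ef : embedding f).
Let KS := @std_inKn n T e n_gt0.

Lemma image_K (U : sK M) :
  (forall z, Defs.mem z U -> exists t, f SI t = z) -> exists u, f SK u = U.
Proof.
move=> UT; have [h [injh hP]] := kn_members KM U.
have /ex_choice[t tP] l : exists t, f SI t = h l by apply/UT/hP; exists l.
have injt : injective t by move=> l l' el; apply: injh; rewrite -!tP el.
have [w [cw wP]] := fset_of_ord injt.
exists (exist (fun x : {fset T} => is_true (#|` x| == n)) w (introT eqP cw)).
apply: (kn_ext KM) => z; rewrite (embedding_members KS KM Ef) hP /=.
split=> [[x /wP[l <-] <-]|[l <-]]; first by exists l.
by exists (t l) => //; apply/wP; exists l.
Qed.

Lemma image_H (h : sH M) : exists b, f SH b = h.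
Proof.
have [e' [e0 eP _ _ _]] := kn_H KM.
have f0 : f SH false = hzero M := em_h0 Ef.
case: (eP h) => ->; first by exists false.
exists true; case: (eP (f SH true)) => //; rewrite -f0 => h1.
by have := @em_inj _ _ _ _ Ef SH _ _ h1.
Qed.

Lemma image_G (a : sG M) :
  (forall U, ev a U <> hzero M -> exists u, f SK u = U) -> exists g, f SG g = a.
Proof.
move=> aU; have [l lP] := kn_ev_fin KM a.
have [l' lP'] := inj_preim_list l (@em_inj _ _ _ _ Ef SK).
have /ex_choice[h hP] u := image_H (ev a (f SK u)).
have f0 : f SH false = hzero M := em_h0 Ef.
have [|g gP] := @kn_ev_surj n _ KS h.
  by exists l' => u hu; apply/lP'/lP => ev0; apply: hu; apply: (@em_inj _ _ _ _ Ef SH); rewrite hP ev0.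
have ge u : ev (f SG g : sG M) (f SK u) = ev a (f SK u).
  by rewrite -(em_ev Ef) -hP; congr (f SH); exact: gP.
exists g; apply: (kn_ev_inj KM) => U.
have [[u <-]|nU] := pselect (exists u, f SK u = U); first exact: ge.
have [->|h1] := pselect (ev a U = hzero M); last by have /nU := aU _ h1.
have [//|h1] := pselect (ev (f SG g : sG M) U = hzero M).
by have /nU := em_ev_im Ef h1.
Qed.

(** The shift [b] from the base point to [x] may lie outside the image of [f]; [x] is reached as
    soon as [b] is. *)
Lemma image_Gs (x : sGs M) u : f SK u = pG x ->
  exists b, actG b (f SGs (u, fset0)) = x /\ forall c, f SG c = b -> exists p, f SGs p = x.
Proof.
move=> ux; have [|b bP] := kn_actG_trans KM (x := f SGs (u, fset0)) (y := x).
  by rewrite -(em_pG Ef).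
exists b; split=> // c cb; exists (@actG n (std n e) c (u, fset0)).
by rewrite (em_actG Ef) cb.
Qed.

Lemma image_Hs (y : sHs M) u : f SK u = pH y -> exists p, f SHs p = y.
Proof.
move=> ux; have [|m mP] := kn_actH_trans KM (y := f SHs (u, false)) (y' := y).
  by rewrite -(em_pH Ef).
have [b bm] := image_H m; exists (@actH n (std n e) b (u, false)).
by rewrite (em_actH Ef) bm.
Qed.

Lemma image_full : (forall z, exists t, f SI t = z) -> forall s c, exists d, f s d = c.
Proof.
move=> sI1; have sK1 U : exists u, f SK u = U by apply: image_K => z _.
have sG1 a : exists g, f SG g = a by apply: image_G => U _.
case=> //=.
- exact: image_H.
- move=> x; have [u ux] := sK1 (pG x); have [b [_ bP]] := image_Gs ux.
  by have [c cb] := sG1 b; exact: bP cb.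
- by move=> y; have [u uy] := sK1 (pH y); exact: image_Hs uy.
Qed.

End Images.

Section Elementary.
Variable n : nat.
Hypothesis n_gt1 : 1 < n.
Let n_gt0 : 0 < n := ltnW n_gt1.
Implicit Types M N : struc n.

(** Quantifying over all target models allows an extension found inside one model to be copied in
    any other: the forth step, freed from the two models being compared. *)
Definition lifts (T T' : choiceType) e e' (phi : emb (std n (T := T) e) (std n (T := T') e')) : Prop :=
  forall M (f : emb (std n e) M), inKn M -> infinite_type (sI M) -> embedding f ->
  exists g : emb (std n e') M, embedding g /\ forall s c, g s (phi s c) = f s c.

Definition refines M (T T' : choiceType) e e' (f : emb (std n (T := T) e) M)
    (g : emb (std n (T := T') e') M) : Prop :=
  exists2 phi : emb (std n e) (std n e'), lifts phi & forall s c, g s (phi s c) = f s c.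

Lemma refines_refl M (T : choiceType) e (f : emb (std n (T := T) e) M) : refines f f.
Proof. by exists (fun s c => c) => // N g _ _ Eg; exists g. Qed.

Lemma refines_trans M (T T' T'' : choiceType) e e' e'' (f : emb (std n (T := T) e) M)
    (g : emb (std n (T := T') e') M) (h : emb (std n (T := T'') e'') M) :
  refines f g -> refines g h -> refines f h.
Proof.
move=> [phi lphi gphi] [psi lpsi hpsi]; exists (emb_comp psi phi).
  move=> N k KN iN Ek; have [k1 [Ek1 kphi]] := lphi _ _ KN iN Ek.
  have [k2 [Ek2 kpsi]] := lpsi _ _ KN iN Ek1.
  by exists k2; split=> // s c; rewrite /emb_comp kpsi kphi.
by move=> s c; rewrite /emb_comp hpsi gphi.
Qed.

Lemma refines_image M (T T' : choiceType) e e' (f : emb (std n (T := T) e) M)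
    (g : emb (std n (T := T') e') M) s c :
  refines f g -> (exists d, f s d = c) -> exists d, g s d = c.
Proof. by move=> [phi _ gphi] [d <-]; exists (phi s d). Qed.

Definition covers M (T : finType) e (f : emb (std n (T := T) e) M) s (c : car M s) : Prop :=
  exists (T' : finType) e' (g : emb (std n (T := T') e') M),
    [/\ embedding g, refines f g & exists d, g s d = c].

Lemma cover_points M (l : list (sI M)) (T : finType) e (f : emb (std n (T := T) e) M) :
  inKn M -> embedding f ->
  exists (T' : finType) e' (g : emb (std n (T := T') e') M),
    [/\ embedding g, refines f g & forall p, List.In p l -> exists t, g SI t = p].
Proof.
move=> KM; elim: l T e f => [|p l IH] T e f Ef.
  by exists T, e, f; split=> //; exact: refines_refl.
have [[t0 pt]|np] := pselect (exists t, f SI t = p).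
  have [T' [e' [g [Eg fg gl]]]] := IH _ _ _ Ef.
  exists T', e', g; split=> // q /= [<-|/gl //].
  by apply: (refines_image (s := SI) fg); exists t0.
pose i (o : option T) : sI M := if o is Some t then f SI t else p.
have injI : injective i.
  move=> [t|] [t'|] //= et; first by congr Some; exact: (@em_inj _ _ _ _ Ef SI).
    by case: np; exists t.
  by case: np; exists t'.
have sinj : injective (@Some T) by move=> ? ? [].
have [//|e2 [phi [h [r bphi Eh hI hphi]]]] := extend_chart n_gt1 sinj KM Ef injI.
have fh : refines f h.
  by exists phi => // N k KN iN Ek; exact: forth r bphi Ek.
have [T' [e' [g [Eg hg gl]]]] := IH (option T : finType) _ _ Eh.
exists T', e', g; split=> //; first exact: refines_trans hg.
move=> q /= [<-|/gl //]; apply: (refines_image (s := SI) hg).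
by exists None; rewrite hI.
Qed.

Lemma cover_K M (T : finType) e (f : emb (std n (T := T) e) M) (U : sK M) :
  inKn M -> embedding f -> covers f (s := SK) U.
Proof.
move=> KM Ef; have [h [injh hP]] := kn_members KM U.
have [T' [e' [g [Eg fg gl]]]] := cover_points (map h (enum 'I_n)) KM Ef.
exists T', e', g; split=> //; apply: (image_K n_gt1 KM Eg) => z /hP[l <-].
by apply: gl; apply/In_map; exists l; split=> //; apply/In_mem; rewrite mem_enum.
Qed.

Lemma members_list M (l : list (sK M)) : inKn M ->
  exists l', forall U z, List.In U l -> Defs.mem z U -> List.In z l'.
Proof.
move=> KM; elim: l => [|V l [l' IH]]; first by exists nil.
have [h [injh hP]] := kn_members KM V.
exists (map h (enum 'I_n) ++ l') => U z /= [<-|Ul] zU; apply/List.in_app_iff; last first.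
  by right; apply: IH zU.
left; have [j <-] := (hP z).1 zU; apply/In_map; exists j; split=> //.
by apply/In_mem; rewrite mem_enum.
Qed.

Lemma cover_G M (T : finType) e (f : emb (std n (T := T) e) M) (a : sG M) :
  inKn M -> embedding f -> covers f (s := SG) a.
Proof.
move=> KM Ef; have [l lP] := kn_ev_fin KM a; have [l' lP'] := members_list l KM.
have [T' [e' [g [Eg fg gl]]]] := cover_points l' KM Ef.
exists T', e', g; split=> //; apply: (image_G n_gt1 KM Eg) => U /lP Ul.
by apply: (image_K n_gt1 KM Eg) => z zU; apply: gl; exact: lP' zU.
Qed.

Lemma cover M (T : finType) e (f : emb (std n (T := T) e) M) s (c : car M s) :
  inKn M -> embedding f -> covers f c.
Proof.
move=> KM Ef; case: s c => /= [z|U|h|a|x|y].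
- have [T' [e' [g [Eg fg gl]]]] := cover_points [:: z] KM Ef.
  by exists T', e', g; split=> //; apply: gl; left.
- exact: cover_K.
- by exists T, e, f; split; [|exact: refines_refl|exact: (image_H KM Ef)].
- exact: cover_G.
(* Two enlargements are made: first for the stalk of [x], then for the group element carrying its
   base point to [x]. *)
- have [T' [e' [g [Eg fg [u ux]]]]] := cover_K (pG x) KM Ef.
  have [b [bx _]] := image_Gs KM Eg ux.
  have [T2 [e2 [h [Eh gh [d db]]]]] := cover_G b KM Eg.
  exists T2, e2, h; split=> //; first exact: refines_trans gh.
  have [p px] : exists p, h SGs p = g SGs (u, fset0).
    by apply: (refines_image (s := SGs) gh); exists (u, fset0).
  exists (@actG n (std n e2) d p); rewrite (em_actG Eh) db px.
  exact: bx.
have [T' [e' [g [Eg fg [u ux]]]]] := cover_K (pH y) KM Ef.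
by exists T', e', g; split=> //; exact: (image_Hs KM Eg ux).
Qed.

Lemma upd_same M (rho : assignment M) s i (a : car M s) : upd rho i a s i = a.
Proof.
rewrite /upd; case: sort_eq_dec => // es; rewrite eqxx.
by rewrite (Prop_irrelevance es erefl).
Qed.

Lemma upd_other M (rho : assignment M) s i (a : car M s) s' j :
  ~ (s = s' /\ i = j) -> upd rho i a s' j = rho s' j.
Proof.
rewrite /upd; case: sort_eq_dec => // es nij; case: eqP => // eji.
by case: nij.
Qed.

Definition similar M N (L : list (Defs.sort * nat)) (rho : assignment M) (rho' : assignment N) : Prop :=
  exists (T : finType) e (f : emb (std n (T := T) e) M) (f' : emb (std n e) N),
    [/\ embedding f, embedding f' &
      forall s j, List.In (s, j) L -> exists c, rho s j = f s c /\ rho' s j = f' s c].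

Lemma similar_sym M N L (rho : assignment M) (rho' : assignment N) :
  similar L rho rho' -> similar L rho' rho.
Proof.
move=> [T [e [f [f' [Ef Ef' h]]]]]; exists T, e, f', f; split=> // s j /h[c [? ?]].
by exists c.
Qed.

Lemma teval_similar M N (T : choiceType) e (f : emb (std n (T := T) e) M) (f' : emb (std n e) N)
    (rho : assignment M) (rho' : assignment N) s0 (t : term s0) :
  embedding f -> embedding f' ->
  (forall s j, tfree t s j -> exists c, rho s j = f s c /\ rho' s j = f' s c) ->
  exists c, teval rho t = f s0 c /\ teval rho' t = f' s0 c.
Proof.
move=> Ef Ef'; elim: t => /=.
- by move=> s i h; apply: h.
- move=> t IH /IH[c [-> ->]]; exists (@pG n (std n e) c).
  by rewrite (em_pG Ef) (em_pG Ef').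
- move=> t IH /IH[c [-> ->]]; exists (@pH n (std n e) c).
  by rewrite (em_pH Ef) (em_pH Ef').
- by move=> _; exists (hzero (std n e)); rewrite (em_h0 Ef) (em_h0 Ef').
- move=> t1 IH1 t2 IH2 h.
  have [|c [-> ->]] := IH1; first by move=> s j ?; apply: h; left.
  have [|d [-> ->]] := IH2; first by move=> s j ?; apply: h; right.
  by exists (@hadd n (std n e) c d); rewrite (em_hadd Ef) (em_hadd Ef').
- move=> t1 IH1 t2 IH2 h.
  have [|c [-> ->]] := IH1; first by move=> s j ?; apply: h; left.
  have [|d [-> ->]] := IH2; first by move=> s j ?; apply: h; right.
  by exists (@ev n (std n e) c d); rewrite (em_ev Ef) (em_ev Ef').
- by move=> _; exists (gzero (std n e)); rewrite (em_g0 Ef) (em_g0 Ef').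
- move=> t1 IH1 t2 IH2 h.
  have [|c [-> ->]] := IH1; first by move=> s j ?; apply: h; left.
  have [|d [-> ->]] := IH2; first by move=> s j ?; apply: h; right.
  by exists (@gadd n (std n e) c d); rewrite (em_gadd Ef) (em_gadd Ef').
- move=> t1 IH1 t2 IH2 h.
  have [|c [-> ->]] := IH1; first by move=> s j ?; apply: h; left.
  have [|d [-> ->]] := IH2; first by move=> s j ?; apply: h; right.
  by exists (@actG n (std n e) c d); rewrite (em_actG Ef) (em_actG Ef').
move=> t1 IH1 t2 IH2 h.
have [|c [-> ->]] := IH1; first by move=> s j ?; apply: h; left.
have [|d [-> ->]] := IH2; first by move=> s j ?; apply: h; right.
by exists (@actH n (std n e) c d); rewrite (em_actH Ef) (em_actH Ef').
Qed.

(** Karp's back-and-forth. One implication is enough, since both models stay quantified in the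
    induction and negation exchanges them. An existential witness is captured by a larger chart,
    which then lifts to the other model. *)
Lemma sat_similar (phi : formula n) : forall L M N (rho : assignment M) (rho' : assignment N),
  inKn M -> inKn N -> infinite_type (sI M) -> infinite_type (sI N) ->
  (forall s j, Defs.free phi s j -> List.In (s, j) L) ->
  similar L rho rho' -> sat rho phi -> sat rho' phi.
Proof.
elim: phi => /=.
- move=> s t u L M N rho rho' KM KN iM iN frL [T [e [f [f' [Ef Ef' h]]]]].
  have [|c [-> ->]] := teval_similar (rho := rho) (rho' := rho') (t := t) Ef Ef'.
    by move=> s' j ft; apply/h/frL; left.
  have [|d [-> ->]] := teval_similar (rho := rho) (rho' := rho') (t := u) Ef Ef'.
    by move=> s' j ft; apply/h/frL; right.
  by move=> /(em_inj Ef) ->.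
- move=> t u L M N rho rho' KM KN iM iN frL [T [e [f [f' [Ef Ef' h]]]]].
  have [|c [-> ->]] := teval_similar (rho := rho) (rho' := rho') (t := t) Ef Ef'.
    by move=> s' j ft; apply/h/frL; left.
  have [|d [-> ->]] := teval_similar (rho := rho) (rho' := rho') (t := u) Ef Ef'.
    by move=> s' j ft; apply/h/frL; right.
  by move=> /(em_mem Ef) h1; apply/(em_mem Ef').
- move=> t u L M N rho rho' KM KN iM iN frL [T [e [f [f' [Ef Ef' h]]]]].
  have [|c [-> ->]] := teval_similar (rho := rho) (rho' := rho') (t := t) Ef Ef'.
    by move=> s' j ft; apply/h/frL; left.
  have [|d [-> ->]] := teval_similar (rho := rho) (rho' := rho') (t := u) Ef Ef'.
    by move=> s' j ft; apply/h/frL; right.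
  by move=> /(em_supp Ef) h1; apply/(em_supp Ef').
- move=> ts u L M N rho rho' KM KN iM iN frL [T [e [f [f' [Ef Ef' h]]]]].
  have /ex_choice[c cP] l : exists c, teval rho (ts l) = f SGs c /\ teval rho' (ts l) = f' SGs c.
    by apply: teval_similar Ef Ef' _ => s' j ft; apply/h/frL; left; exists l.
  have [|d [-> ->]] := teval_similar (rho := rho) (rho' := rho') (t := u) Ef Ef'.
    by move=> s' j ft; apply/h/frL; right.
  have -> : (fun l => teval rho (ts l)) = (fun l => f SGs (c l)) by apply: funext => l; rewrite (cP l).1.
  have -> : (fun l => teval rho' (ts l)) = (fun l => f' SGs (c l)) by apply: funext => l; rewrite (cP l).2.
  by move=> /(em_Q Ef) h1; apply/(em_Q Ef').
- move=> phi IH L M N rho rho' KM KN iM iN frL sim nphi phi'; apply: nphi.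
  exact: IH (similar_sym sim) phi'.
- move=> F IH L M N rho rho' KM KN iM iN frL sim all k.
  apply: (IH k L M N rho rho') => // s j fk; apply: frL; by exists k.
move=> s i phi IH L M N rho rho' KM KN iM iN frL [T [e [f [f' [Ef Ef' h]]]]] [a sata].
have [T2 [e2 [g [Eg [psi lpsi gpsi] [c gc]]]]] := cover a KM Ef.
have [g' [Eg' gpsi']] := lpsi _ _ KN iN Ef'.
exists (g' s c); apply: (IH ((s, i) :: L) M N (upd rho i a)) => //.
  move=> s' j fr; have [e1|ne] := pselect (s = s' /\ i = j).
    by left; case: e1 => -> ->.
  by right; apply: frL.
exists T2, e2, g, g'; split=> // s' j inL.
have [[e1 e2']|ne] := pselect (s = s' /\ i = j).
  by subst s' j; exists c; rewrite !upd_same.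
rewrite !upd_other //; have /h[d [-> ->]] : List.In (s', j) L.
  by case: inL => // -[e1 e2']; case: ne.
by exists (psi s' d); rewrite gpsi gpsi'.
Qed.

(** As n > 0, the empty index set has no n-subsets, hence no base points to choose; this is where
    the back-and-forth starts. *)
Lemma empty_chart M : inKn M ->
  exists f : emb (std n (T := void) (fun _ _ => false)) M, embedding f.
Proof.
move=> KM; have no (u : nset n void) : False.
  have : #|` val u| = 0.
    by apply/eqP; rewrite cardfs_eq0; apply/eqP/fsetP => -[].
  by rewrite card_nset => n0; move: n_gt0; rewrite n0.
have [|||f [Ef _ _ _]] := @chart n n_gt0 void (fun _ _ => false) M (fun v => match v with end)
  (fun u => False_rect _ (no u)) (fun u => False_rect _ (no u)) KM (fun v => match v with end).
- by move=> u; case: (no u).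
- by move=> u; case: (no u).
- by move=> us v; case: (no v).
by exists f.
Qed.

Lemma embedding_elem M N (f : emb M N) :
  inKn M -> inKn N -> infinite_type (sI M) -> embedding f -> elem f.
Proof.
move=> KM KN iM Ef phi rho [m mP].
have iN : infinite_type (sI N).
  move=> l; have [l' lP] := inj_preim_list l (@em_inj _ _ _ _ Ef SI).
  by have [x nx] := iM l'; exists (f SI x) => /lP.
(* Since the formula has finitely many free variables, their values fit into a single finite
   chart. *)
pose L := List.list_prod [:: SI; SK; SH; SG; SGs; SHs] (iota 0 m).
have frL s j : Defs.free phi s j -> List.In (s, j) L.
  move=> /mP jm; apply/List.in_prod_iff; split; last by apply/In_mem; rewrite mem_iota.
  by case: s; rewrite /=; tauto.
have [T [e [g [Eg gL]]]] : exists (T : finType) e (g : emb (std n (T := T) e) M),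
    embedding g /\ forall s j, List.In (s, j) L -> exists c, g s c = rho s j.
  elim: (L) => [|[s j] L' [T [e [g [Eg gL]]]]].
    by have [g Eg] := empty_chart KM; exists void, (fun _ _ => false), g.
  have [T' [e' [h [Eh gh hc]]]] := cover (rho s j) KM Eg.
  exists T', e', h; split=> // s' j' /= [[<- <-] //|/gL].
  exact: refines_image.
have sim : similar L rho (fun s j => f s (rho s j)).
  exists T, e, g, (emb_comp f g); split=> //; first exact: embedding_comp.
  by move=> s j /gL[c <-]; exists c.
split; first exact: (sat_similar KM KN iM iN frL sim).
exact: (sat_similar KN KM iN iM frL (similar_sym sim)).
Qed.

End Elementary.

(** * Cardinality of standard models *)

Lemma nat_le_infinite A : card_le nat A -> infinite_type A.
Proof.
move=> natA l; have [x xl] := @nat_le_notin {classic A} A id l (fun x y xy => xy) natA.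
by exists x => /(@In_mem {classic A}); apply/negP.
Qed.

Lemma std_universe_le n k U (J : choiceType) e : isAleph k U -> card_le J U ->
  card_le (universe (@std n J e)) U.
Proof.
move=> Uk JU; have natU := nat_le_aleph Uk; have UU := aleph_square Uk.
have seqU A : card_le A U -> card_le (seq A) U.
  move=> [f injf]; apply: card_le_trans (card_le_seq natU UU).
  by exists (map f); exact: inj_map.
have prodU A B : card_le A U -> card_le B U -> card_le (A * B) U.
  by move=> AU BU; apply: card_le_trans (UU); exact: card_le_prod.
have fsetU (A : choiceType) : card_le A U -> card_le {fset A} U.
  move=> AU; apply: card_le_trans (seqU _ AU); exists (@enum_fset A) => x y exy.
  by apply/fsetP => z; rewrite -[z \in x]/(z \in enum_fset x) exy.
have boolU : card_le bool U by apply: card_le_trans natU; exists nat_of_bool; case; case.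
have KU : card_le (nset n J) U.
  by apply: card_le_trans (fsetU _ JU); exists val; exact: val_inj.
have carU s : card_le (car (std n (T := J) e) s) U.
  by case: s => //=; [exact: fsetU|apply: prodU => //; exact: fsetU|exact: prodU].
pose c s := sval (cid (carU s)); have injc s : injective (c s) := svalP (cid (carU s)).
have sortU : card_le Defs.sort U.
  apply: card_le_trans natU.
  by exists (fun s =>
    match s with SI => 0 | SK => 1 | SH => 2 | SG => 3 | SGs => 4 | SHs => 5 end); case; case.
apply: card_le_trans UU; have [h injh] := sortU.
exists (fun p : universe (std n (T := J) e) => (h (projT1 p), c _ (projT2 p))).
by move=> [s x] [t y] [/injh /= est]; subst t => /injc ->.
Qed.

Lemma std_inKl n k U (J : choiceType) e : 0 < n -> isAleph k U ->
  card_le J U -> card_le U (universe (@std n J e)) -> inKl k (@std n J e).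
Proof.
move=> n0 Uk JU UJ; split; first exact: std_inKn.
exact: isAleph_eq Uk (card_le_antisym UJ (std_universe_le _ _ Uk JU)).
Qed.

(** * Elementary maps are embeddings *)

Section ElemEmbedding.
Variable n : nat.
Hypothesis n_gt0 : 0 < n.

(** With an empty sort there would be no assignment, and [elem] would hold vacuously. An infinite
    index set supplies n distinct indices, hence a stalk index and elements over it. *)
Lemma assignment_exists (M : struc n) : inKn M -> infinite_type (sI M) ->
  inhabited (assignment M).
Proof.
move=> KM iM; have [z0 _] := iM nil.
have /ex_choice[h hP] : forall l : seq (sI M), exists z, ~ List.In z l := iM.
pose fix s m : seq (sI M) := if m is m'.+1 then h (s m') :: s m' else [::].
pose f (m : 'I_n) := h (s m).
have sub m m' : m < m' -> List.In (h (s m)) (s m').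
  elim: m' => // m' IH; rewrite ltnS leq_eqVlt => /orP[/eqP->|/IH]; first by left.
  by right.
have injf : injective f.
  move=> i j e; apply: val_inj; case: (ltngtP i j) => // lt.
    by case: (hP (s j)); rewrite -[h (s j)]/(f j) -e; exact: sub.
  by case: (hP (s i)); rewrite -[h (s i)]/(f i) e; exact: sub.
have [u _] := kn_full KM injf.
have [x _] := kn_pG_onto KM u; have [y _] := kn_pH_onto KM u.
constructor => s' _; case: s'; [exact: z0|exact: u|exact: hzero|exact: gzero|exact: x|exact: y].
Qed.

(** All clauses but the last are instances of atomic formulas; the last one needs a formula bounding
    the support of [a] by a finite list. *)
Lemma elem_embedding (M N : struc n) (f : emb M N) :
  inKn M -> infinite_type (sI M) -> elem f -> embedding f.
Proof.
move=> KM iM Ef; have [r0] := assignment_exists KM iM.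
have fin (phi : formula n) m : (forall s j, Defs.free phi s j -> j < m) -> finfree phi by exists m.
split.
- move=> s x y e; have := Ef (fEq n (tvar s 0) (tvar s 1)) (upd (upd r0 0 x) 1 y).
  rewrite /= upd_same upd_other ?upd_same; last by case.
  case; first by apply: (fin _ 2) => s' j /= [] [_ <-].
  by move=> _; apply.
- move=> z u; apply: iff_sym.
  apply: (Ef (fMem n (tvar SI 0) (tvar SK 0)) (upd (upd r0 0 (z : car M SI)) 0 (u : car M SK))).
  by apply: (fin _ 2) => s' j /= [] [_ <-].
- have [|h _] := Ef (fEq n (tvar SH 0) th0) (upd r0 0 (hzero M : car M SH)).
    by apply: (fin _ 2) => s' j /= [] // [_ <-].
  exact: h.
- move=> a b; have [|h _] := Ef (fEq n (tvar SH 0) (thadd (tvar SH 1) (tvar SH 2)))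
     (upd (upd (upd r0 0 (hadd a b : car M SH)) 1 (a : car M SH)) 2 (b : car M SH)).
    by apply: (fin _ 3) => s' j /=; intuition subst.
  exact: h.
- have [|h _] := Ef (fEq n (tvar SG 0) tg0) (upd r0 0 (gzero M : car M SG)).
    by apply: (fin _ 2) => s' j /= [] // [_ <-].
  exact: h.
- move=> a b; have [|h _] := Ef (fEq n (tvar SG 0) (tgadd (tvar SG 1) (tvar SG 2)))
     (upd (upd (upd r0 0 (gadd a b : car M SG)) 1 (a : car M SG)) 2 (b : car M SG)).
    by apply: (fin _ 3) => s' j /=; intuition subst.
  exact: h.
- move=> a u; have [|h _] := Ef (fEq n (tvar SH 0) (tev (tvar SG 1) (tvar SK 2)))
     (upd (upd (upd r0 0 (ev a u : car M SH)) 1 (a : car M SG)) 2 (u : car M SK)).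
    by apply: (fin _ 3) => s' j /=; intuition subst.
  exact: h.
- move=> a u; apply: iff_sym.
  apply: (Ef (fSupp n (tvar SG 0) (tvar SK 0)) (upd (upd r0 0 (a : car M SG)) 0 (u : car M SK))).
  by apply: (fin _ 2) => s' j /= [] [_ <-].
- move=> x; have [|h _] := Ef (fEq n (tvar SK 0) (tpG (tvar SGs 1)))
     (upd (upd r0 0 (pG x : car M SK)) 1 (x : car M SGs)).
    by apply: (fin _ 3) => s' j /=; intuition subst.
  exact: h.
- move=> a x; have [|h _] := Ef (fEq n (tvar SGs 0) (tactG (tvar SG 1) (tvar SGs 2)))
     (upd (upd (upd r0 0 (actG a x : car M SGs)) 1 (a : car M SG)) 2 (x : car M SGs)).
    by apply: (fin _ 3) => s' j /=; intuition subst.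
  exact: h.
- move=> x; have [|h _] := Ef (fEq n (tvar SK 0) (tpH (tvar SHs 1)))
     (upd (upd r0 0 (pH x : car M SK)) 1 (x : car M SHs)).
    by apply: (fin _ 3) => s' j /=; intuition subst.
  exact: h.
- move=> a x; have [|h _] := Ef (fEq n (tvar SHs 0) (tactH (tvar SH 1) (tvar SHs 2)))
     (upd (upd (upd r0 0 (actH a x : car M SHs)) 1 (a : car M SH)) 2 (x : car M SHs)).
    by apply: (fin _ 3) => s' j /=; intuition subst.
  exact: h.
- move=> x y.
  pose rho : assignment M := fun s => match s return nat -> car M s with
    | SGs => fun i => x (insubd (Ordinal n_gt0) i) | SHs => fun=> y | s => r0 s end.
  have [|h1 h2] := Ef (fQ (fun l => tvar SGs l) (tvar SHs 0)) rho.
    by apply: (fin _ n) => s' j /= [[l [_ <-]]|[_ <-]].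
  move: h1 h2 => /=; have -> : (fun l : 'I_n => x (insubd (Ordinal n_gt0) (val l))) = x.
    by apply: funext => l; rewrite valKd.
  have -> // : (fun l : 'I_n => f SGs (x (insubd (Ordinal n_gt0) (val l)))) = (fun l => f SGs (x l)).
  by apply: funext => l; rewrite valKd.
move=> a U evU; apply: contrapT => noU.
have [l lP] := kn_ev_fin KM a; pose u0 : sK M := r0 SK 0.
pose rho : assignment M := fun s => match s return nat -> car M s with
    | SK => fun i => if i is i'.+1 then nth u0 l i' else u0
    | SG => fun=> a | s => r0 s end.
(* No element of the support of [a] differs from all listed ones. Conjunctions being infinite,
   [minn] sends the late conjuncts to one variable with the default value [u0], which keeps the free
   variables finite in number. *)
pose phi : formula n := fNeg (fEx SK 0 (fConj (fun i =>
  if i is i'.+1 then fNeg (fEq n (tvar SK 0) (tvar SK (minn i' (size l)).+1))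
  else fNeg (fEq n (tev (tvar SG 0) (tvar SK 0)) th0)))).
have [|h _] := Ef phi rho.
  apply: (fin _ (size l).+2) => s j /= [[i] fr _]; case: i fr => /= [|i]; first by intuition subst.
  by move=> [[_ <-]|[_ <-]] //; rewrite !ltnS geq_minr.
apply: h => /=.
  move=> [u hu]; have := hu 0; rewrite /upd /= => /lP ul.
  have [i [il ei]] : exists i, i < size l /\ nth u0 l i = u.
    elim: (l) ul => [//|v l' IH] /= [->|/IH[i [il ei]]]; first by exists 0.
    by exists i.+1.
  have := hu i.+1; rewrite /upd /= (minn_idPl (ltnW il)); apply.
  by rewrite ei.
exists U; case=> [|i]; rewrite /upd /=; first exact: evU.
by move=> eU; apply: noU; exists (nth u0 l (minn i (size l))).
Qed.

End ElemEmbedding.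

(** * Inequivalent amalgams *)

Lemma imfset_preim (A B : choiceType) (j : A -> B) (w : {fset B}) : injective j ->
  (forall z, z \in w -> exists a, j a = z) -> exists w' : {fset A}, w = [fset j a | a in w'].
Proof.
move=> jinj wj; have [l lP] := inj_preim_list (enum_fset w) jinj.
exists [fset a in l | j a \in w]; apply/fsetP => z; apply/idP/imfsetP => [zw|[a /=]]; last first.
  by rewrite !inE => /andP[_ aw] ->.
have [a az] := wj z zw; exists a => //=; rewrite !inE az zw andbT.
by apply/In_mem/lP/In_mem; rewrite az.
Qed.

Lemma nmap_preim n (A B : choiceType) (j : A -> B) (jinj : injective j) (u : nset n B) :
  (forall z, z \in val u -> exists a, j a = z) -> exists u', u = nmap jinj u'.
Proof.
move=> /(imfset_preim jinj)[w ew].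
have cw : #|` w| == n by apply/eqP; have := card_nset u; rewrite ew card_imfset.
exists (exist (fun x : {fset A} => is_true (#|` x| == n)) w cw).
exact: val_inj.
Qed.

Lemma hsum0 n (N : struc n) (gam : 'I_n -> sG N) V m : inKn N ->
  (forall l, ev (gam l) V = hzero N) -> hsum gam V m = m.
Proof.
move=> KN gam0; have [e [_ eP h00 h0e _]] := kn_H KN.
have h0 h : hadd (hzero N) h = h by case: (eP h) => ->.
by rewrite /hsum; elim: (enum 'I_n) => [//|l s IH] /=; rewrite gam0 IH h0.
Qed.

(* The point b of the two amalgams is None. *)
Lemma twist_no_amalgam n X (J : choiceType) (j : X -> J) (a : J) ea eb (N : struc n)
    (ga : emb (@std n (option J) ea) N) (gb : emb (@std n (option J) eb) N) (c0 c1 : X) :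
  3 <= n -> isAleph (n - 3) X -> injective j -> (forall x, j x <> a) -> c0 <> c1 ->
  (forall w v, None \in w -> ea w v = false) ->
  (forall w v, None \in w -> eb w v =
     [&& Some a \in w, Some (j c0) \in w & Some (j c0) \notin v]) ->
  inKn N -> embedding ga -> embedding gb -> (forall t, ga SI t = gb SI t) ->
  (forall u : nset n (option J), None \notin val u \/
      (forall z, z \in val u -> exists x, omap j x = z) ->
     ga SGs (u, fset0) = gb SGs (u, fset0)) -> False.
Proof.
move=> n3 Xk jinj ja c01 eaE ebE KN Ea Eb gI gGs.
have n1 : 1 < n by apply: leq_trans n3.
have n0 : 0 < n by apply: leq_trans n3.
have Ka := @std_inKn n _ ea n0; have Kb := @std_inKn n _ eb n0.
have gK u : ga SK u = gb SK u.
  apply: (kn_ext KN) => z.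
  rewrite (embedding_members Ka KN Ea) (embedding_members Kb KN Eb).
  by split=> -[t tu <-]; exists t => //; rewrite gI.
have pGs u : pG (ga SGs (u, fset0)) = pG (gb SGs (u, fset0)).
  by rewrite -(em_pG Ea) -(em_pG Eb); exact: gK.
(* [g] and [h] measure the displacement between the base points of the two amalgams. *)
have /ex_choice[g gP] u := kn_actG_trans KN (pGs u).
have /ex_choice[h hP] u : exists m, actH m (ga SHs (u, false)) = gb SHs (u, false).
  by apply: (kn_actH_trans KN); rewrite -(em_pH Ea) -(em_pH Eb); exact: gK.
have g0 u : None \notin val u \/ (forall z, z \in val u -> exists x, omap j x = z) -> g u = gzero N.
  move=> /gGs gu; apply: (kn_actG_free KN (x := ga SGs (u, fset0))).
  by rewrite gP (kn_actG_zero KN).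
pose c (i : bool) := if i then c1 else c0.
pose base (r : {fset J}) : {fset option J} := None |` (Some a |` [fset Some z | z in r]).
(* The points [j (c i)] are included so that a free set avoids them. The other points belong to
   stalk indices in the support of the displacement over {a, b} + r + c_i, and there are finitely
   many of them. *)
pose F (r : {fset J}) (z : J) := exists i : bool, z = j (c i) \/
  exists u v : nset n (option J), [/\ val u = Some (j (c i)) |` base r,
    Some z \in val v & ev (g u) (ga SK v) <> hzero N].
have finF r : exists l : seq J, forall z, F r z -> z \in l.
  have fin i : exists l : seq J, forall z, (z = j (c i) \/ exists u v : nset n (option J),
     [/\ val u = Some (j (c i)) |` base r, Some z \in val v & ev (g u) (ga SK v) <> hzero N]) -> z \in l.
    have [[u uE]|nu] := pselect (exists u : nset n (option J), val u = Some (j (c i)) |` base r); last first.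
      exists [:: j (c i)] => z [->|[u [v [uE _ _]]]]; first by rewrite inE.
      by case: nu; exists u.
    have [l lP] := kn_ev_fin KN (g u); have [l' lP'] := members_list l KN.
    have injS : injective (fun z : J => ga SI (Some z)).
      by move=> z z' e; have [] : Some z = Some z' by exact: (@em_inj _ _ _ _ Ea SI).
    have [l2 lP2] := inj_preim_list l' injS.
    exists (j (c i) :: l2) => z [->|[u' [v [u'E zv evv]]]]; first by rewrite inE eqxx.
    rewrite inE; apply/orP; right; apply/In_mem/lP2.
    have eu : u' = u by apply: val_inj; rewrite u'E uE.
    subst u'; apply: (lP' (ga SK v)); first exact: lP.
    by apply/(em_mem Ea).
  have [l0 l0P] := fin false; have [l1 l1P] := fin true.
  exists (l0 ++ l1) => z [[] Fz]; rewrite mem_cat; apply/orP; [right|left].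
    exact: l1P.
  exact: l0P.
have [s [sX cs free]] := free_set Xk jinj finF.
have cNs i : j (c i) \notin s.
  by apply/negP => cis; apply: (free _ cis); exists i; left.
have aNs : a \notin s by apply/negP => /sX[x xa]; case: (ja x).
have sinj : injective (@Some J) by move=> ? ? [].
have NnS (r : {fset J}) : None \notin [fset Some z | z in r] by apply/negP => /imfsetP[].
have SS (r : {fset J}) z : (Some z \in [fset Some z | z in r]) = (z \in r) by rewrite mem_imfset.
have baseN r : None \in base r by rewrite fset1U1.
have baseS r z : (Some z \in base r) = (z == a) || (z \in r).
  by rewrite !inE /= SS.
(* The free set has n - 3 + 1 points; [None] and [a] bring the size to n. *)
have cv : #|` base s| == n.
  rewrite /base !cardfsU1 !inE negb_or (negbTE (NnS s)) SS aNs card_imfset //=.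
  by rewrite cs -[X in _ == X](subnK n3) addn3.
pose v : nset n (option J) := exist (fun x : {fset option J} => is_true (#|` x| == n)) (base s) cv.
pose w i := Some (j (c i)) |` base s.
have ciN i : Some (j (c i)) \notin base s.
  by rewrite baseS negb_or cNs andbT; apply/eqP; exact: ja.
have cw i : #|` w i| = n.+1 by rewrite /w cardfsU1 ciN (eqP cv).
have vw i : val v `<=` w i by exact: fsubsetU1.
have wN i : None \in w i by rewrite !inE orbT.
have wa i : Some a \in w i by rewrite inE baseS eqxx orbT.
have ebw i : eb (w i) (val v) = ~~ i.
  rewrite ebE // wa (ciN false) andbT /w /=; case: i; last by rewrite fset1U1.
  have nb : (Some (j c0) \in base s) = false by apply/negbTE/(ciN false).
  by rewrite in_fset1U nb orbF; apply/eqP => -[/jinj].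
(* On the base points over [w i], [Q] holds in the first amalgam for both [i] but in the second only
   for [i = true]; hence the total displacement vanishes exactly for [i = true]. *)
have sums i : exists2 us, simplex us v (w i) &
    (hsum (fun l => g (us l)) (ga SK v) (h v) = hzero N <-> i).
  have [us Sw] := simplex_exists (cw i) (vw i); exists us => //.
  have Qa : Q (fun l => ga SGs (us l, fset0)) (ga SHs (v, false)).
    apply/(em_Q Ea (fun l => (us l, fset0)) (v, false)).
    by apply: (proj2 (std_base_Q n1 ea Sw)); rewrite eaE.
  have Qb : Q (fun l => gb SGs (us l, fset0)) (gb SHs (v, false)) <-> i.
    apply: (iff_trans (em_Q Eb (fun l => (us l, fset0)) (v, false))).
    apply: (iff_trans (std_base_Q n1 eb Sw)); rewrite ebw.
    by case: (i).
  have := kn_Q_act KN (kn_Q_compat KN Qa) (fun l => g (us l)) (h v).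
  have -> : (fun l => actG (g (us l)) (ga SGs (us l, fset0))) = (fun l => gb SGs (us l, fset0)).
    by apply: funext => l.
  by rewrite hP -(em_pH Ea); tauto.
(* A facet omits a point of [v]. If this is [None] or [a], the facet lies in N or in M1, where the
   displacement is zero; if it is a point of [s], a nonzero value would contradict freeness. *)
have facet i us l : simplex us v (w i) -> ev (g (us l)) (ga SK v) = hzero N.
  move=> Sw; apply: contrapT => evl.
  have [z zv uE] := simplex_facet l Sw; rewrite /= in zv.
  have gn0 : g (us l) <> gzero N by move=> e; apply: evl; rewrite e (kn_ev_zero KN).
  case: z zv uE => [z|] zv uE; last by apply: gn0; apply: g0; left; rewrite uE !inE.
  move: zv; rewrite baseS; case: (eqVneq z a) uE => [->|za] uE /= zs.
    apply: gn0; apply: g0; right => t; rewrite uE in_fsetD1 => /andP[ta].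
    rewrite in_fset1U => /orP[/eqP->|]; first by exists (Some (c i)).
    case: t ta => [t|] ta; last by exists None.
    rewrite baseS => /orP[/eqP et|/sX[x <-]]; last by exists (Some x).
    by rewrite et eqxx in ta.
  apply: (free z zs); exists i; right; exists (us l), v; split=> //=; last by rewrite baseS zs orbT.
  rewrite uE; apply/fsetP => -[t|]; last by rewrite !inE.
  rewrite in_fsetD1 /w in_fset1U [in RHS]in_fset1U !baseS in_fsetD1.
  rewrite (inj_eq sinj); case: (eqVneq t z) => [->|tz] //=; rewrite ?(negbTE za) /=.
  by rewrite orbF; apply/esym/eqP => -[e]; have := cNs i; rewrite -e zs.
(* Without the facet terms both sums reduce to [h v], which does not depend on [i]. *)
have [us0 S0 h0] := sums false; have [us1 S1 h1] := sums true.
rewrite hsum0 // in h0; last by move=> l; exact: facet S0.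
rewrite hsum0 // in h1; last by move=> l; exact: facet S1.
by have := h0.1 (h1.2 isT).
Qed.

Lemma universe_inj n (M : struc n) s (x y : car M s) :
  existT (car M) s x = existT (car M) s y -> x = y.
Proof. exact: (Eqdep_dec.inj_pair2_eq_dec _ sort_eq_dec). Qed.

Definition eps0 (T : choiceType) (_ _ : {fset T}) : bool := false.

Theorem theorem6p6 (n : nat) (hn : 3 <= n) : ~ weakly_successful n (n - 3).
Proof.
move=> ws; have n1 : 1 < n by apply: leq_trans hn.
have n0 : 0 < n by apply: leq_trans hn.
have [X0 Xk0] := isAleph_exists (n - 3); pose X : choiceType := {classic X0}.
have Xk : isAleph (n - 3) X := Xk0.
have natX := nat_le_aleph Xk.
have [f0 injf0] := natX.
have XM (J : choiceType) e : card_le J (universe (@std n J e)).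
  by exists (fun x => existT (car (std n e)) SI x) => x y /universe_inj.
have KlX e : inKl (n - 3) (@std n X e) by apply: std_inKl Xk _ (XM _ _) => //; exact: card_le_refl.
have oX : card_le (option X) X := card_le_option_inf natX.
have Xo : card_le X (option X) by exists Some => ? ? [].
have KloX e : inKl (n - 3) (@std n (option X) e).
  by apply: std_inKl Xk oX (card_le_trans Xo (XM _ _)).
have infX : infinite_type X := nat_le_infinite natX.
have sinjX : injective (@Some X) by move=> ? ? [].
(* [phi] has two roles: together with the point [None] it is the triple whose type is to be
   represented, and it is the extension M1 of M on which uniqueness is tested. *)
have [phi bphi] :=
  @base_emb_exists n n1 X (option X) Some sinjX (@eps0 X) (@eps0 (option X)) (fun _ _ _ _ => erefl).
have [Ephi phiI phiGs phiHs] := bphi.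
have Lphi : elem phi by apply: (embedding_elem n1 (KlX _).1 (KloX _).1).
pose e := @Ext n (std n (@eps0 X)) (std n (@eps0 (option X))) phi None.
have [||e' [[KlM [KlN Lei] nba uniq] _]] := ws (std n (@eps0 X)) e (KlX _).
- by split; [exact: KloX|exact: Lphi].
- by move=> [x]; rewrite /= phiI.
case: e' KlN Lei nba uniq => N ei a /= KlN Lei nba uniq.
have KN := KlN.1.
have Eei := elem_embedding n0 (KlX _).1 infX Lei.
pose J : choiceType := {classic sI N}; pose j : X -> J := ei SI.
have jinj : injective j := @em_inj _ _ _ _ Eei SI.
(* The whole of N is coordinatised over its own index set, compatibly with M; since all indices are
   reached, [cN] is an isomorphism, with inverse [cV]. *)
have [e1 [psi [cN [r1 bpsi EcN cNI cNpsi]]]] :=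
  @extend_chart n n1 X J j jinj (@eps0 X) N ei (fun x => x) KN Eei (fun x y xy => xy) (fun=> erefl).
have full := image_full n1 KN EcN (fun z => ex_intro _ z (cNI z)).
pose cV : emb N (std n e1) := fun s c => sval (cid (full s c)).
have cVK s c : cN s (cV s c) = c := svalP (cid (full s c)).
have KV s c : cV s (cN s c) = c by apply: (em_inj EcN); rewrite cVK.
have EcV := embedding_inv EcN cVK.
pose unsome (w : {fset option J}) : {fset J} := [fset z in pmap id (enum_fset w)].
have sinjJ : injective (@Some J) by move=> ? ? [].
have unsomeK w : unsome [fset Some z | z in w] = w.
  by apply/fsetP => z; rewrite inE /= mem_pmap map_id mem_imfset.
(* [d] prescribes [Q] on the simplices through the new point; elsewhere the values of N are kept. *)
pose tw (d : {fset option J} -> {fset option J} -> bool) (w v : {fset option J}) :=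
  if None \in w then d w v else e1 (unsome w) (unsome v).
have ojinj : injective (omap j) by move=> [x|] [y|] //= [] /jinj ->.
have rS d : restricts n (@Some J) e1 (tw d).
  move=> w v cw vw; rewrite /tw !unsomeK; case: imfsetP => // -[] //.
have oS (r : {fset X}) : [fset omap j x | x in [fset Some y | y in r]] =
    [fset Some z | z in [fset j y | y in r]].
  apply/fsetP => z; apply/imfsetP/imfsetP => -[? /= /imfsetP[y /= yr ->] ->].
    by exists (j y) => //; exact: in_imfset.
  by exists (Some y) => //; exact: in_imfset.
(* Simplices of M1 never contain [a], because [a] is not in the image of M; so M1 embeds once [d]
   vanishes on the simplices without [a]. *)
have rO d : (forall w v, Some (a : J) \notin w -> d w v = false) ->
    restricts n (omap j) (@eps0 (option X)) (tw d).
  move=> dP w v cw vw; rewrite /tw; case: imfsetP => [_|Nw].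
    apply: dP; apply/imfsetP => -[[x|] //= _ [ax]].
    by apply: nba; exists x.
  have some (r : {fset option X}) : r `<=` w -> exists r' : {fset X}, r = [fset Some x | x in r'].
    move=> rw; apply: (imfset_preim sinjX) => -[x|] xr; first by exists x.
    by case: Nw; exists None => //; exact: (fsubsetP rw).
  have [w' ew] := some w (fsubset_refl w).
  have [|v' ev] := nmap_preim sinjX (u := v).
    by move=> [x|] xv; [exists x|case: Nw; exists None => //; exact: (fsubsetP vw)].
  have eS : val v = [fset Some y | y in val v'] by rewrite ev.
  rewrite eS ew !oS !unsomeK; rewrite r1 //.
    by move: cw; rewrite ew card_imfset.
  apply/fsubsetP => x xv; have : Some x \in w.
    by apply: (fsubsetP vw); rewrite eS; exact: in_imfset.
  by rewrite ew mem_imfset.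
have KlJ d : inKl (n - 3) (std n (tw d)).
  have [_ Nk] := KlN.
  have JU : card_le J (universe N).
    by exists (fun x => existT (car N) SI x) => x y /universe_inj.
  apply: (@std_inKl n _ _ (option J) (tw d) n0 Nk).
    exact: card_le_trans (card_le_option JU) (card_le_option_inf (nat_le_aleph Nk)).
  have [f [Ef _ _ _]] := base_emb_exists n1 sinjJ (rS d).
  have Eg := embedding_comp Ef EcV.
  exists (fun p => existT (car (std n (tw d))) (projT1 p) (emb_comp f cV (projT2 p))).
  move=> [s x] [t y] /= exy; have /= est := congr1 (@projT1 _ _) exy; subst t.
  by have /(em_inj Eg) -> := universe_inj exy.
have infN : infinite_type (sI N).
  apply: nat_le_infinite; exists (j \o f0); exact: inj_comp.
have natJ : card_le nat (option J).
  by exists (fun m => Some (j (f0 m))) => x y [] /jinj /injf0.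
have nn u : nmap ojinj (nmap sinjX u) = nmap sinjJ (nmap jinj u) :> nset n (option J).
  by apply: val_inj; exact: oS.
have [psiE psiI psiGs psiHs] := bpsi.
(* Both maps send base points to base points, which later forces the displacement to vanish over N
   and over M1. *)
have amalgam d : (forall w v, Some (a : J) \notin w -> d w v = false) ->
    exists (f1 : emb N (std n (tw d))) (f2 : emb (std n (@eps0 (option X))) (std n (tw d))),
    [/\ @nf_amalgam n (n - 3) _ (Ext ei a) _ phi _ f1 f2,
       forall u, f1 SGs (cN SGs (u, fset0)) = (nmap sinjJ u, fset0),
       forall u, f2 SGs (u, fset0) = (nmap ojinj u, fset0),
       forall z, f1 SI z = Some (z : J) & f2 SI None = None].
  move=> dP; have [f [Ef fI fGs fHs]] := base_emb_exists n1 sinjJ (rS d).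
  have [f2 [Ef2 f2I f2Gs f2Hs]] := base_emb_exists n1 ojinj (rO d dP).
  have Ef1 := embedding_comp Ef EcV.
  have f1I (z : J) : emb_comp f cV (s := SI) z = Some z.
    by rewrite /emb_comp fI; congr Some; rewrite -[RHS](cVK SI) cNI.
  exists (emb_comp f cV), f2; split=> //.
  - split.
    + exact: KlJ.
    + exact: (embedding_elem n1 KN (KlJ d).1 infN).
    + apply: (embedding_elem n1 (KloX _).1 (KlJ d).1) => //.
      by apply: nat_le_infinite; exact: card_le_trans natX Xo.
    + move=> s c; rewrite /= -cNpsi /emb_comp KV.
      apply: (std_emb_unique (KlJ d).1 (embedding_comp Ef psiE) (embedding_comp Ef2 Ephi)) => x;
        rewrite /emb_comp.
      * by rewrite psiI fI phiI f2I.
      * by rewrite psiGs fGs phiGs f2Gs nn.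
      * by rewrite psiHs fHs phiHs f2Hs nn.
    + move=> [y]; rewrite f2I f1I; case: y => [x|] // [ax].
      by apply: nba; exists x.
  - by move=> u; rewrite /emb_comp KV fGs.
pose c0 := f0 0; pose c1 := f0 1.
pose d0 (w v : {fset option J}) := false.
pose d1 (w v : {fset option J}) := [&& Some a \in w, Some (j c0) \in w & Some (j c0) \notin v].
have [fa1 [fa2 [Aa fa1Gs fa2Gs fa1I fa2I]]] := amalgam d0 (fun _ _ _ => erefl).
have [|fb1 [fb2 [Ab fb1Gs fb2Gs fb1I fb2I]]] := amalgam d1.
  by move=> w v /negbTE aw; rewrite /d1 aw.
have [_ /(_ _ _ _ _ _ _ Aa Ab)[Ns [ga [gb [KlNs Lga Lgb g1 g2]]]]] := uniq _ phi (KloX _) Lphi.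
have iJ := nat_le_infinite natJ.
apply: (@twist_no_amalgam n X J j a (tw d0) (tw d1) Ns ga gb c0 c1 hn Xk jinj) => //.
- by move=> x xa; apply: nba; exists x.
- by move=> /injf0.
- by move=> w v Nw; rewrite /tw Nw.
- by move=> w v Nw; rewrite /tw Nw.
- exact: KlNs.1.
- exact: (elem_embedding n0 (KlJ d0).1 iJ Lga).
- exact: (elem_embedding n0 (KlJ d1).1 iJ Lgb).
- move=> [z|]; first by have := g1 SI z; rewrite fa1I fb1I.
  by have := g2 SI None; rewrite fa2I fb2I.
(* In either case the base point over [u] is the image of the same element of N or of M1 in both
   amalgams, and there the two maps into [Ns] agree. *)
move=> u [Nu|uX].
  have [|u' ->] := nmap_preim sinjJ (u := u).
    by move=> [z|] zu; [exists z|rewrite zu in Nu].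
  by have := g1 SGs (cN SGs (u', fset0)); rewrite fa1Gs fb1Gs.
have [u' ->] := nmap_preim ojinj uX.
by have := g2 SGs (u', fset0); rewrite fa2Gs fb2Gs.
Qed.
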